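(* The cubic parabola $$\{t+t^2\varepsilon+t^3\varepsilon^2\mid t\in\mathbb{R}\}\subset\mathbb{L}$$ is admissible. A cubic parabola of $\mathbb{L}$ is admissible if, and only if, its projective extension and the projective extension of $\{t+t^2\varepsilon+t^3\varepsilon^2\mid t\in\mathbb{R}\}$ have contact of second order at the point $f=\mathbb{R}(0,0,0,1)$.
   Context: Let $\mathbb{L}=\mathbb{R}[X]/\langle X^3\rangle$, a 3-dimensional commutative local real algebra with basis $1,\varepsilon,\varepsilon^2$, where $\varepsilon=X+\langle X^3\rangle$, so $\varepsilon^3=0$. Its maximal ideal is $N=\mathbb{R}\varepsilon+\mathbb{R}\varepsilon^2$, and $\mathbb{R}$ is regarded as a subring of $\mathbb{L}$. The projective line $\mathbb{P}(\mathbb{L})$ over $\mathbb{L}$ is the set of all cyclic submodules $\mathbb{L}(u,v)\subset\mathbb{L}^2$ such that $u$ or $v$ is a unit of $\mathbb{L}$. The real projective line $\mathbb{P}(\mathbb{R})$ is embedded in it by $\mathbb{R}(x,y)\mapsto\mathbb{L}(x,y)$. The chains are the images of $\mathbb{P}(\mathbb{R})\subset\mathbb{P}(\mathbb{L})$ under the natural right action of $\mathrm{GL}_2(\mathbb{L})$ on $\mathbb{L}^2$. A proper point of $\mathbb{P}(\mathbb{L})$ is one of the form $\mathbb{L}(z,1)$ with $z\in\mathbb{L}$, and it is identified with $z\in\mathbb{L}$. The proper part $\mathcal{C}^\circ$ of a chain $\mathcal{C}$ is the set of its proper points, regarded as a subset of the real affine 3-space $\mathbb{L}$. The affine space $\mathbb{L}$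 is embedded in its projective closure $\mathbb{P}_3(\mathbb{R})$ by identifying $x_1+x_2\varepsilon+x_3\varepsilon^2\in\mathbb{L}$ with $\mathbb{R}(1,x_1,x_2,x_3)$. The plane at infinity is $\Phi: x_0=0$. A cubic parabola of $\mathbb{L}$ is the affine part of a twisted cubic of $\mathbb{P}_3(\mathbb{R})$ that has $\Phi$ as an osculating plane (equivalently, an image of $\{t+t^2\varepsilon+t^3\varepsilon^2\mid t\in\mathbb{R}\}$ under a bijective real affine transformation of $\mathbb{L}$). Its projective extension is the unique twisted cubic of $\mathbb{P}_3(\mathbb{R})$ containing it, obtained by adding one point at infinity. A cubic parabola is called admissible if it is the proper part of a chain. Contact of order $m$ is understood as contact of order at least $m$: two twisted cubics have contact of order $m$ at a point $f$ if both pass through $f$ and, in an affine chart around $f$, they admit smooth regular local parametrizations $g_1,g_2$ with $g_1(0)=g_2(0)=f$ whose derivatives at $0$ agree up to and including order $m$. *)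

(* Defs.v *)
From mathcomp Require Import all_boot all_order all_algebra qpoly.
From mathcomp Require Import all_classical all_reals all_analysis.

Set Implicit Arguments.
Unset Strict Implicit.
Unset Printing Implicit Defensive.

Import Order.TTheory GRing.Theory Num.Theory.
Import numFieldNormedType.Exports.

Local Open Scope ring_scope.
Local Open Scope classical_set_scope.

(* Points of projective spaces are cyclic submodules, as sets of row vectors. *)
Definition cyclic_submod (K : nzRingType) (n : nat) (v : 'rV[K]_n) :
  set 'rV[K]_n := range (fun a : K => a *: v).

Definition proj_line (K : comUnitRingType) : set (set 'rV[K]_2) :=
  [set cyclic_submod v | v in
     [set v : 'rV[K]_2 | v 0 0 \is a GRing.unit \/ v 0 1 \is a GRing.unit]].

Definition Lalg (R : realType) := {poly %/ ('X^3 : {poly R})}.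

Definition eps (R : realType) : Lalg R := in_qpoly 'X^3 'X.

Definition real_line (R : realType) : set (set 'rV[Lalg R]_2) :=
  [set cyclic_submod (map_mx (fun x : R => x%:A : Lalg R) v) | v in
     [set v : 'rV[R]_2 | proj_line (cyclic_submod v)]].

Definition chain (R : realType) (C : set (set 'rV[Lalg R]_2)) : Prop :=
  exists2 G : 'M[Lalg R]_2, G \in unitmx &
    C = [set [set v *m G | v in S] | S in @real_line R].

Definition proper_part (R : realType) (C : set (set 'rV[Lalg R]_2)) :
  set (Lalg R) :=
  [set z | C (cyclic_submod (\row_(i < 2) [:: z; 1]`_i))].

Definition homog (R : realType) (x : 'rV[R]_3) : 'rV[R]_4 :=
  row_mx (1 : 'M[R]_1) x.

Definition affine_embed (R : realType) (z : Lalg R) : set 'rV[R]_4 :=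
  cyclic_submod (homog (\row_(i < 3) (z : {poly R})`_i)).

(* The underlying 3-dimensional subspace of the plane at infinity x_0 = 0. *)
Definition plane_at_infinity (R : realType) : set 'rV[R]_4 :=
  [set x | x 0 0 = 0].

Definition twisted_cubic (R : realType) (T : set (set 'rV[R]_4)) : Prop :=
  exists2 M : 'M[R]_4, M \in unitmx &
    T = [set cyclic_submod ((\row_(i < 4) (u.1 ^+ (3 - i) * u.2 ^+ i)) *m M)
          | u in [set u : R * R | u != (0, 0)]].

(* An invertible A encodes the affine chart x |-> R((1, x) A) of P_3(R);
   every affine chart has this form. *)
Definition chart_lift (R : realType) (A : 'M[R]_4) (x : 'rV[R]_3) : 'rV[R]_4 :=
  homog x *m A.

Definition chart_pt (R : realType) (A : 'M[R]_4) (x : 'rV[R]_3) :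
  set 'rV[R]_4 := cyclic_submod (chart_lift A x).

Definition smooth_near0 (R : realType) (g : R -> 'rV[R]_3) : Prop :=
  \forall t \near (0 : R), forall k : nat, derivable (derive1n k g) t 1.

(* The last clause says that g maps every neighbourhood of 0 onto a
   neighbourhood of f in T. *)
Definition local_param (R : realType) (A : 'M[R]_4) (T : set (set 'rV[R]_4))
    (f : set 'rV[R]_4) (g : R -> 'rV[R]_3) : Prop :=
  [/\ smooth_near0 g, derive1 g 0 != 0, chart_pt A (g 0) = f,
      \forall t \near (0 : R), T (chart_pt A (g t)) &
      forall U : set R, nbhs 0 U ->
        \forall x \near g 0, T (chart_pt A x) -> (g @` U) x].

(* Contact of order at least m. *)
Definition contact (R : realType) (m : nat) (T1 T2 : set (set 'rV[R]_4))
    (f : set 'rV[R]_4) : Prop :=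
  [/\ T1 f, T2 f & exists2 A : 'M[R]_4, A \in unitmx &
    exists g1 g2 : R -> 'rV[R]_3,
      [/\ local_param A T1 f g1, local_param A T2 f g2 &
          forall k : nat, (k <= m)%N -> derive1n k g1 0 = derive1n k g2 0]].

(* E is spanned by the point, the first and the second derivative of a
   homogeneous lift of a regular local parametrization. *)
Definition osculating_plane (R : realType) (T : set (set 'rV[R]_4))
    (E : set 'rV[R]_4) : Prop :=
  exists2 f, T f & exists2 A : 'M[R]_4, A \in unitmx &
    exists2 g : R -> 'rV[R]_3, local_param A T f g &
      E = [set x | (x <= \matrix_(i < 3)
                     derive1n i (fun t => chart_lift A (g t)) 0)%MS].

Definition cubic_parabola (R : realType) (P : set (Lalg R)) : Prop :=
  exists T : set (set 'rV[R]_4),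
    [/\ twisted_cubic T, osculating_plane T (@plane_at_infinity R) &
        P = @affine_embed R @^-1` T].

(* The unique twisted cubic containing the cubic parabola P; the default value
   set0 is never taken when P is a cubic parabola. *)
Definition projective_extension (R : realType) (P : set (Lalg R)) :
  set (set 'rV[R]_4) :=
  xget set0 [set T | twisted_cubic T /\ @affine_embed R @` P `<=` T].

Definition admissible (R : realType) (P : set (Lalg R)) : Prop :=
  cubic_parabola P /\ exists2 C, chain C & P = proper_part C.

Definition std_parabola (R : realType) : set (Lalg R) :=
  range (fun t : R => t%:A + t ^+ 2 *: eps R + t ^+ 3 *: eps R ^+ 2).

Definition pt_f (R : realType) : set 'rV[R]_4 :=
  cyclic_submod (\row_(i < 4) [:: 0; 0; 0; 1]`_i).

(* Main.v *)
Require Import Defs.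
From mathcomp Require Import all_boot all_order all_algebra qpoly.
From mathcomp Require Import all_classical all_reals all_analysis.
From mathcomp Require Import ring.

Set Implicit Arguments.
Unset Strict Implicit.
Unset Printing Implicit Defensive.

Import Order.TTheory GRing.Theory Num.Theory.
Import numFieldNormedType.Exports.

Local Open Scope ring_scope.
Local Open Scope classical_set_scope.

(** The contact condition at f and admissibility both amount to the same
    equations on the coefficients of a cubic parabola.

    A twisted cubic is the image of the Veronese curve (s^3, s^2 t, s t^2, t^3)
    under an invertible 4 x 4 matrix M.  If the plane at infinity is an
    osculating plane, then after moving its point of contact to (s, t) = (0, 1)
    the plane x_0 = 0 pulls back to s^3 = 0, so that the first column of M can be
    normalised to (1, 0, 0, 0) ([osculating_affine_normal]).  The cubic parabola
    is then { q + t a + t^2 b + t^3 c } with the rows (1, q), (0, a), (0, b),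
    (0, c) of M, and the equations are ([admissible_coefs])
      c_1 = c_2 = 0,   b_1 = 0,   a_1 c_3 = b_2^2.

    Contact implies the equations.  A curve lying on the cubic of M satisfies
    three quadratic equations in the coordinates y = x M^-1; differentiating them
    twice at the point y = (0, 0, 0, w) gives y_0' = y_1' = y_0'' = 0 and
    w y_1'' = 2 y_2'^2 ([jets_on_cubic]).  If two curves with equal 2-jets lie on
    the cubics of M and of the identity matrix, comparing these relations yields
    the equations ([contact_admissible_coefs]).

    The equations hold for chains and imply contact.  After a real
    reparametrization and a scaling, a chain is the set of all
    be + al t (1 + ga t)^-1 with al a unit and ga nilpotent, and as ga^3 = 0 its
    proper part is { be + t al - t^2 al ga + t^3 al ga^2 } ([chain_curve_ex]).
    Its matrix satisfies the equations: al ga^2 is a multiple of eps^2, al ga is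
    nilpotent and (al_0) (al_0 ga_1^2) = (al_0 ga_1)^2.  Conversely the equations
    say that b^2 = a c in the algebra, so that al = a and ga = - b / a produce a
    chain ([admissible_coefs_chain]).  Under the equations a parameter change
    t |-> la t + mu brings M, up to a scalar, to the form [model_mx], for which
    the 2-jet at f of an explicit rational parametrization does not depend on the
    remaining coefficients; hence all these cubics are in contact with the one of
    the identity matrix ([model_contact]).

    Two twisted cubics with infinitely many common points are equal
    ([cubic_of_eq]), because the quadrics that cut out one of them restrict to
    binary forms of degree six on the other.  This identifies the projective
    extensions, and it allows one to replace the given matrix of an admissible
    parabola by the matrix read off from its chain ([chain_contact]). *)

(** * Row vectors and matrices of size four *)

Notation o0 := (@Ordinal 4 0 isT).
Notation o1 := (@Ordinal 4 1 isT).
Notation o2 := (@Ordinal 4 2 isT).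
Notation o3 := (@Ordinal 4 3 isT).

Notation i0 := (@Ordinal 3 0 isT).
Notation i1 := (@Ordinal 3 1 isT).
Notation i2 := (@Ordinal 3 2 isT).

Lemma sum4E (V : nmodType) (F : 'I_4 -> V) :
  \sum_i F i = F o0 + F o1 + F o2 + F o3.
Proof.
rewrite !big_ord_recl big_ord0 addr0 !addrA.
by congr (F _ + F _ + F _ + F _); apply: val_inj.
Qed.

Lemma ord4P (P : 'I_4 -> Prop) : P o0 -> P o1 -> P o2 -> P o3 -> forall i, P i.
Proof.
move=> P0 P1 P2 P3 [[|[|[|[|//]]]] lt_i]; have eqP := bool_irrelevance lt_i isT.
- by rewrite eqP.
- by rewrite eqP.
- by rewrite eqP.
- by rewrite eqP.
Qed.

Section Cubics.
Variable R : realType.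
Implicit Types (u : R * R) (M N : 'M[R]_4) (x y : 'rV[R]_4).

Definition row4 (a b c d : R) : 'rV[R]_4 := \row_(j < 4) [:: a; b; c; d]`_j.
Definition mx4 (r0 r1 r2 r3 : 'rV[R]_4) : 'M[R]_4 :=
  \matrix_(i < 4) nth 0 [:: r0; r1; r2; r3] i.

Lemma row4E a b c d :
  (row4 a b c d 0 o0 = a) * (row4 a b c d 0 o1 = b) *
  (row4 a b c d 0 o2 = c) * (row4 a b c d 0 o3 = d).
Proof. by rewrite !mxE. Qed.

Lemma row4P x y : x 0 o0 = y 0 o0 -> x 0 o1 = y 0 o1 -> x 0 o2 = y 0 o2 ->
  x 0 o3 = y 0 o3 -> x = y.
Proof. by move=> *; apply/rowP; apply: ord4P. Qed.

Lemma row_mx_row4 (c : 'M[R]_1) (x : 'rV[R]_3) :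
  row_mx c x = row4 (c 0 0) (x 0 i0) (x 0 i1) (x 0 i2).
Proof.
apply: row4P; rewrite row4E.
- by rewrite -[RHS](row_mxEl c x); congr (row_mx _ _ _ _); apply: val_inj.
- by rewrite -[RHS](row_mxEr c x); congr (row_mx _ _ _ _); apply: val_inj.
- by rewrite -[RHS](row_mxEr c x); congr (row_mx _ _ _ _); apply: val_inj.
- by rewrite -[RHS](row_mxEr c x); congr (row_mx _ _ _ _); apply: val_inj.
Qed.

Lemma homogE (x : 'rV[R]_3) : homog x = row4 1 (x 0 i0) (x 0 i1) (x 0 i2).
Proof. by rewrite /homog row_mx_row4 mxE. Qed.

Lemma row3P (x y : 'rV[R]_3) :
  x 0 i0 = y 0 i0 -> x 0 i1 = y 0 i1 -> x 0 i2 = y 0 i2 -> x = y.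
Proof.
move=> *; apply/rowP => -[[|[|[|//]]] lt_i]; have eqP := bool_irrelevance lt_i isT.
- by rewrite eqP.
- by rewrite eqP.
- by rewrite eqP.
Qed.

Lemma mulrow4 n a b c d (M : 'M[R]_(4, n)) :
  row4 a b c d *m M = a *: row o0 M + b *: row o1 M + c *: row o2 M + d *: row o3 M.
Proof. by apply/rowP=> j; rewrite !mxE sum4E !mxE. Qed.

Lemma row_mx4 r0 r1 r2 r3 : [/\ row o0 (mx4 r0 r1 r2 r3) = r0,
  row o1 (mx4 r0 r1 r2 r3) = r1, row o2 (mx4 r0 r1 r2 r3) = r2 &
  row o3 (mx4 r0 r1 r2 r3) = r3].
Proof. by split; apply/rowP=> j; rewrite !mxE. Qed.

Lemma mulrow4_mx4 a b c d r0 r1 r2 r3 :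
  row4 a b c d *m mx4 r0 r1 r2 r3 = a *: r0 + b *: r1 + c *: r2 + d *: r3.
Proof. by rewrite mulrow4; case: (row_mx4 r0 r1 r2 r3) => -> -> -> ->. Qed.

Lemma cyclic_submodP (n : nat) (x y : 'rV[R]_n) :
  cyclic_submod x = cyclic_submod y <-> exists2 k, k != 0 & x = k *: y.
Proof.
split=> [exy|[k k0 ->]]; last first.
  apply/seteqP; split=> _ [a _ <-].
    by exists (a * k) => //; rewrite scalerA.
  by exists (a / k) => //; rewrite scalerA divfK.
have: cyclic_submod y x by rewrite -exy; exists 1; rewrite ?scale1r.
case=> k _ kyE; have: cyclic_submod x y by rewrite exy; exists 1; rewrite ?scale1r.
case=> l _ lxE; have [k0|k0] := eqVneq k 0; last by exists k.
exists 1; rewrite ?oner_eq0 // scale1r -lxE -kyE k0 scale0r scaler0 //.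
Qed.

(** * Twisted cubics *)

Definition vero u := row4 (u.1 ^+ 3) (u.1 ^+ 2 * u.2) (u.1 * u.2 ^+ 2) (u.2 ^+ 3).

Definition cubic_of M : set (set 'rV[R]_4) :=
  [set cyclic_submod (vero u *m M) | u in [set u : R * R | u != (0, 0)]].

Lemma twisted_cubicP T :
  twisted_cubic T <-> exists2 M, M \in unitmx & T = cubic_of M.
Proof.
have veroE u : vero u = \row_(i < 4) (u.1 ^+ (3 - i) * u.2 ^+ i).
  by apply: row4P; rewrite !mxE /= ?expr0 ?expr1 ?mulr1 ?mul1r //.
rewrite /twisted_cubic.
by split=> -[M uM ->]; exists M => //; rewrite /cubic_of;
   apply: eq_imagel => u _; rewrite veroE.
Qed.

Lemma vero_eq0 u : (vero u == 0) = (u == (0, 0)).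
Proof.
apply/eqP/eqP=> [v0|->]; last by apply: row4P; rewrite !mxE /= ?expr0n /= ?mul0r.
have /eqP := congr1 (fun x : 'rV_4 => x 0 o0) v0.
have /eqP := congr1 (fun x : 'rV_4 => x 0 o3) v0.
by rewrite !mxE /= !expf_eq0 /= => /eqP u2 /eqP u1; case: u u1 u2 {v0} => /= ? ? -> ->.
Qed.

Lemma veroZ k u : vero (k * u.1, k * u.2) = k ^+ 3 *: vero u.
Proof. by apply: row4P; rewrite !mxE /=; ring. Qed.

Lemma poly_eq0_roots (p : {poly R}) (r : nat -> R) :
  injective r -> (forall n, root p (r n)) -> p = 0.
Proof.
move=> r_inj pr; apply/eqP/negP => /negP p0.
have := @max_poly_roots _ p (map r (iota 0 (size p))) p0.
rewrite size_map size_iota ltnn map_inj_uniq // iota_uniq => /(_ _ isT) H.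
suff : false by [].
by apply: H; apply/allP=> _ /mapP[n _ ->].
Qed.

Definition cubic_poly (a b c d : R) : {poly R} :=
  a%:P + b *: 'X + c *: 'X^2 + d *: 'X^3.

Lemma horner_cubic_poly a b c d t :
  (cubic_poly a b c d).[t] = a + b * t + c * t ^+ 2 + d * t ^+ 3.
Proof. by rewrite !hornerE. Qed.

Lemma cubic_poly_eq0 a b c d :
  cubic_poly a b c d = 0 -> [/\ a = 0, b = 0, c = 0 & d = 0].
Proof.
move=> p0; have E i : (cubic_poly a b c d)`_i = 0 by rewrite p0 coef0.
move: (E 0%N) (E 1%N) (E 2%N) (E 3%N).
by rewrite !coefD !coefZ !coefC !coefXn !coefX /= !(mulr0, mulr1, addr0, add0r).
Qed.

Lemma vero_mulE u (n : nat) (M : 'M[R]_(4, n)) j : (vero u *m M) 0 j =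
  u.1 ^+ 3 * M o0 j + u.1 ^+ 2 * u.2 * M o1 j + u.1 * u.2 ^+ 2 * M o2 j
  + u.2 ^+ 3 * M o3 j.
Proof. by rewrite mulrow4 !mxE. Qed.

Lemma natr_inj : injective (fun n : nat => n%:R : R).
Proof. by move=> m n /eqP; rewrite eqr_nat => /eqP. Qed.

(** The Veronese curve spans: its four coordinates are linearly independent
    polynomials.  In particular a twisted cubic lies in no plane. *)
Lemma vero_mul_eq0 (n : nat) (M : 'M[R]_(4, n)) :
  (forall t, vero (1, t) *m M = 0) -> M = 0.
Proof.
move=> M0; apply/matrixP=> i j; rewrite mxE.
have /cubic_poly_eq0 [] : cubic_poly (M o0 j) (M o1 j) (M o2 j) (M o3 j) = 0.
  apply: (poly_eq0_roots natr_inj) => k; apply/rootP.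
  have := congr1 (fun x : 'rV_n => x 0 j) (M0 k%:R).
  by rewrite vero_mulE mxE horner_cubic_poly /= => <-; ring.
by move: i; apply: ord4P.
Qed.

Definition on_quadrics y :=
  [/\ y 0 o0 * y 0 o2 = y 0 o1 * y 0 o1, y 0 o1 * y 0 o3 = y 0 o2 * y 0 o2
    & y 0 o0 * y 0 o3 = y 0 o1 * y 0 o2].

Lemma on_quadrics_vero k u : on_quadrics (k *: vero u).
Proof. by split; rewrite !mxE /=; ring. Qed.

(** The three quadrics cut out the cone over the Veronese curve: away from
    y_0 = 0 the parameter is (y_0, y_1), and on y_0 = 0 they force
    y_1 = y_2 = 0. *)
Lemma on_quadricsP y :
  y != 0 -> on_quadrics y -> exists2 u, u != (0, 0) & exists2 k, k != 0 & y = k *: vero u.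
Proof.
move=> y0 [q1 q2 q3].
suff [u [k]] : exists u k, k != 0 /\ y = k *: vero u.
  case=> k0 yE; exists u; last by exists k.
  by apply: contraNneq y0 => u0; rewrite yE scaler_eq0 vero_eq0 u0 eqxx orbT.
have [a0|a0] := eqVneq (y 0 o0) 0; last first.
  exists (y 0 o0, y 0 o1), (y 0 o0 ^- 2); split; first by rewrite invr_eq0 expf_neq0.
  have E : y 0 o2 = y 0 o1 ^+ 2 / y 0 o0 by rewrite expr2 -q1 mulrC mulKf.
  have E3 : y 0 o3 = y 0 o1 ^+ 3 / y 0 o0 ^+ 2.
    by apply: (mulfI a0); rewrite q3 E; field.
  by apply: row4P; rewrite !mxE /= ?E ?E3; field.
have b0 : y 0 o1 = 0 by apply/eqP; rewrite -[_ == 0]orbb -mulf_eq0 -q1 a0 mul0r.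
have c0 : y 0 o2 = 0 by apply/eqP; rewrite -[_ == 0]orbb -mulf_eq0 -q2 b0 mul0r.
exists (0, 1), (y 0 o3); split; last by apply: row4P; rewrite !mxE /= ?a0 ?b0 ?c0; ring.
apply: contraNneq y0 => d0; apply/eqP.
by apply: row4P; rewrite mxE.
Qed.

Lemma cubic_ofP M x : M \in unitmx ->
  cubic_of M (cyclic_submod x) <-> x != 0 /\ on_quadrics (x *m invmx M).
Proof.
move=> uM; split=> [[u u0 /esym/cyclic_submodP[k k0 xE]]|[x0 qx]].
  rewrite xE -scalemxAl mulmxK //; split; last exact: on_quadrics_vero.
  rewrite scaler_eq0 (negPf k0) /=; apply: contraNneq u0 => vM0.
  by rewrite -vero_eq0 -[vero u](mulmxK uM) vM0 mul0mx.
have [|u u0 [k k0 xE]] := on_quadricsP _ qx.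
  by apply: contraNneq x0 => xM0; rewrite -[x](mulmxKV uM) xM0 mul0mx.
exists u => //; apply/esym/cyclic_submodP; exists k => //.
by rewrite scalemxAl -xE mulmxKV.
Qed.

(** The equations of [on_quadrics], in a form that treats the three uniformly. *)
Definition quadric (i j k l : 'I_4) x := x 0 i * x 0 j - x 0 k * x 0 l.

Lemma quadricZ i j k l c x : quadric i j k l (c *: x) = c ^+ 2 * quadric i j k l x.
Proof. by rewrite /quadric !mxE; ring. Qed.

Lemma on_quadricsE y : on_quadrics y <->
  [/\ quadric o0 o2 o1 o1 y = 0, quadric o1 o3 o2 o2 y = 0
    & quadric o0 o3 o1 o2 y = 0].
Proof.
rewrite /on_quadrics /quadric; split=> -[q1 q2 q3].
  by rewrite q1 q2 q3 !subrr.
by split; apply/eqP; rewrite -subr_eq0; apply/eqP.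
Qed.

(** The value of a quadric along the image of the Veronese curve is a binary form
    of degree six, which vanishes as soon as it has infinitely many pairwise
    nonproportional zeros.  The form is handled through its two
    dehomogenisations, at s = 1 for the points with s != 0 and at t = 1 for the
    remaining point. *)
Lemma quadric_vanish M i j k l (u : nat -> R * R) :
    (forall m n, (u m).1 * (u n).2 = (u n).1 * (u m).2 -> m = n) ->
    (forall n, quadric i j k l (vero (u n) *m M) = 0) ->
  forall v, quadric i j k l (vero v *m M) = 0.
Proof.
move=> u_inj qu0; pose q := quadric i j k l.
have qZ c v : q (vero (c * v.1, c * v.2) *m M) = (c ^+ 3) ^+ 2 * q (vero v *m M).
  by rewrite veroZ -scalemxAl /q quadricZ.
pose p b := if b is true
  then fun j => cubic_poly (M o0 j) (M o1 j) (M o2 j) (M o3 j)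
  else fun j => cubic_poly (M o3 j) (M o2 j) (M o1 j) (M o0 j).
have q1E t : q (vero (1, t) *m M) =
    (p true i * p true j - p true k * p true l).[t].
  by rewrite /q /quadric !vero_mulE !hornerE /=; ring.
have q2E t : q (vero (t, 1) *m M) =
    (p false i * p false j - p false k * p false l).[t].
  by rewrite /q /quadric !vero_mulE !hornerE /=; ring.
(* At most one of the parameters is proportional to (0, 1); the sequence is cut off
   behind it. *)
have [m0 u_neq0] : exists m0 : nat, forall n, (u (m0 + n)%N).1 != 0.
  have [[m um0]|none] := pselect (exists m, (u m).1 = 0); last first.
    by exists 0%N => n; apply/eqP=> un0; apply: none; exists (0 + n)%N.
  exists m.+1 => n; apply/eqP=> un0.
  have := u_inj m (m.+1 + n)%N; rewrite um0 un0 !mul0r => /(_ erefl) mE.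
  by have := ltnn m; rewrite {2}mE ltnS leq_addr.
have q1 t : q (vero (1, t) *m M) = 0.
  rewrite q1E; set Q := _ - _; suff -> : Q = 0 by rewrite horner0.
  apply: (@poly_eq0_roots _ (fun n => (u (m0 + n)%N).2 / (u (m0 + n)%N).1)).
  - move=> m n /eqP; rewrite eqr_div // => /eqP mn; apply/(@addnI m0)/u_inj.
    by rewrite mulrC -mn mulrC.
  - move=> n; apply/rootP; rewrite -q1E; apply/eqP.
    have un0 := u_neq0 n; have := qZ (u (m0 + n)%N).1^-1 (u (m0 + n)%N).
    rewrite mulVf // [_^-1 * _]mulrC [q (vero (u _) *m _)]qu0 mulr0 => ->.
    by rewrite eqxx.
have q2 s t : s != 0 -> q (vero (s, t) *m M) = 0.
  move=> s0; have := qZ s (1, t / s); rewrite q1 mulr0 /= mulr1.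
  by rewrite mulrCA mulfV // mulr1.
have q3 : q (vero (0, 1) *m M) = 0.
  rewrite q2E; set Q := _ - _; suff -> : Q = 0 by rewrite horner0.
  apply: (@poly_eq0_roots _ (fun n : nat => n.+1%:R)).
  - by move=> m n /natr_inj [].
  - by move=> n; apply/rootP; rewrite -q2E q2 // pnatr_eq0.
case=> s t; have [->|s0] := eqVneq s 0; last exact: q2.
by have := qZ t (0, 1); rewrite q3 !mulr0 mulr1.
Qed.

(** The quadrics that cut out the second cubic vanish at infinitely many points
    of the first one, hence on all of it. *)
Lemma cubic_of_sub M N (x : nat -> 'rV[R]_4) : M \in unitmx -> N \in unitmx ->
    (forall m n, cyclic_submod (x m) = cyclic_submod (x n) -> m = n) ->
    (forall n, cubic_of M (cyclic_submod (x n))) ->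
    (forall n, cubic_of N (cyclic_submod (x n))) ->
  cubic_of M `<=` cubic_of N.
Proof.
move=> uM uN x_inj xM xN _ [v v0 <-].
have /choice[u uP] n : exists u, exists2 k, k != 0 & x n = k *: (vero u *m M).
  have [u _ /esym/cyclic_submodP[k k0 xE]] := xM n.
  by exists u, k.
have u0 n : u n != (0, 0).
  apply/eqP=> un0; have [k k0 xE] := uP n.
  have /(cubic_ofP _ uM)[] := xM n.
  have /eqP vn0 : vero (u n) == 0 by rewrite vero_eq0 un0.
  by rewrite xE vn0 mul0mx scaler0 eqxx.
have u_inj m n : (u m).1 * (u n).2 = (u n).1 * (u m).2 -> m = n.
  move=> umn; apply: x_inj; apply/cyclic_submodP.
  have [km km0 ->] := uP m; have [kn kn0 ->] := uP n.
  have [c c0 umE] : exists2 c, c != 0 & u m = (c * (u n).1, c * (u n).2).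
    move: (u0 m) (u0 n) umn; case: (u m) => a b; case: (u n) => a' b' /=.
    rewrite !xpair_eqE !negb_and.
    have [->|a0] := eqVneq a' 0 => /=.
      move=> ab0 b0 /eqP; rewrite mul0r mulf_eq0 (negPf b0) orbF => /eqP a0.
      rewrite a0 eqxx /= in ab0 *; exists (b / b'); rewrite ?mulf_neq0 ?invr_eq0 //.
      by rewrite mulr0 divfK.
    move=> ab0 _ E; exists (a / a').
      rewrite mulf_neq0 ?invr_eq0 //; apply: contraTneq ab0 => a00.
      move/eqP: E; rewrite a00 mul0r eq_sym mulf_eq0 (negPf a0) /= => /eqP ->.
      by rewrite !eqxx.
    by rewrite divfK // mulrAC E mulrC mulKf.
  exists (km * c ^+ 3 / kn); first by rewrite !mulf_neq0 ?invr_eq0 // expf_neq0.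
  by rewrite umE veroZ -!scalemxAl !scalerA divfK.
have quN n : on_quadrics (vero (u n) *m (M *m invmx N)).
  have /(cubic_ofP _ uN)[_] := xN n; have [k k0 ->] := uP n.
  rewrite -scalemxAl -mulmxA => /on_quadricsE; rewrite !quadricZ.
  case=> q1 q2 q3; apply/on_quadricsE.
  have k2 : k ^+ 2 != 0 by rewrite expf_neq0.
  by split; apply: (mulfI k2); rewrite mulr0.
apply/cubic_ofP => //; split.
  apply: contraNneq v0 => vM0.
  by rewrite -vero_eq0 -[vero v](mulmxK uM) vM0 mul0mx.
rewrite -mulmxA; apply/on_quadricsE.
by split; apply: (@quadric_vanish _ _ _ _ _ u) => // n;
   have /on_quadricsE[] := quN n.
Qed.

Lemma cubic_of_eq M N (x : nat -> 'rV[R]_4) : M \in unitmx -> N \in unitmx ->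
    (forall m n, cyclic_submod (x m) = cyclic_submod (x n) -> m = n) ->
    (forall n, cubic_of M (cyclic_submod (x n))) ->
    (forall n, cubic_of N (cyclic_submod (x n))) ->
  cubic_of M = cubic_of N.
Proof. by move=> *; apply/seteqP; split; apply: (@cubic_of_sub _ _ x). Qed.

(** The action of the 2 x 2 matrix with rows (a, b), (c, d) on binary cubic forms:
    substituting parameters linearly amounts to multiplying the Veronese row by
    this matrix. *)
Definition sym3 (a b c d : R) : 'M[R]_4 :=
  mx4 (vero (a, b))
      (row4 (3 * a ^+ 2 * c) (a ^+ 2 * d + 2 * a * b * c)
            (2 * a * b * d + b ^+ 2 * c) (3 * b ^+ 2 * d))
      (row4 (3 * a * c ^+ 2) (2 * a * c * d + b * c ^+ 2)
            (a * d ^+ 2 + 2 * b * c * d) (3 * b * d ^+ 2))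
      (vero (c, d)).

Lemma vero_sym3 u a b c d :
  vero u *m sym3 a b c d = vero (a * u.1 + c * u.2, b * u.1 + d * u.2).
Proof. by rewrite mulrow4_mx4; apply: row4P; rewrite !mxE /=; ring. Qed.

Lemma vero_inj (n : nat) (M N : 'M[R]_(4, n)) :
  (forall t, vero (1, t) *m M = vero (1, t) *m N) -> M = N.
Proof.
move=> MN; apply/eqP; rewrite -subr_eq0; apply/eqP/vero_mul_eq0 => t.
by rewrite mulmxBr MN subrr.
Qed.

Lemma sym3_unit a b c d : a * d - b * c != 0 -> sym3 a b c d \in unitmx.
Proof.
set D := _ - _ => D0.
suff /mulmx1_unit[] : sym3 a b c d *m sym3 (d / D) (- b / D) (- c / D) (a / D) = 1%:M.
  by [].
apply: vero_inj => t; rewrite mulmxA !vero_sym3 mulmx1 /=; congr vero.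
by congr (_, _); rewrite /D; field.
Qed.

Lemma cubic_of_sym3 a b c d M : a * d - b * c != 0 ->
  cubic_of (sym3 a b c d *m M) = cubic_of M.
Proof.
set D := _ - _ => D0; apply/seteqP; split=> _ [u u0 <-].
  exists (a * u.1 + c * u.2, b * u.1 + d * u.2); last by rewrite mulmxA vero_sym3.
  apply: contraNneq u0 => /= -[E1 E2]; case: u E1 E2 => s t /= E1 E2.
  have sE : s = (d * (a * s + c * t) - c * (b * s + d * t)) / D by rewrite /D; field.
  have tE : t = (a * (b * s + d * t) - b * (a * s + c * t)) / D by rewrite /D; field.
  rewrite xpair_eqE [X in X == _]sE [X in _ && (X == _)]tE E1 E2.
  by rewrite !mulr0 subrr mul0r eqxx.
case: u u0 => s t /= u0; exists ((d * s - c * t) / D, (a * t - b * s) / D).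
  apply: contraNneq u0 => /= -[E1 E2].
  have sE : s = a * ((d * s - c * t) / D) + c * ((a * t - b * s) / D).
    by rewrite /D; field.
  have tE : t = b * ((d * s - c * t) / D) + d * ((a * t - b * s) / D).
    by rewrite /D; field.
  by rewrite xpair_eqE [X in X == _]sE [X in _ && (X == _)]tE E1 E2 !mulr0 addr0 eqxx.
rewrite mulmxA vero_sym3 /=; congr (cyclic_submod (vero _ *m _)).
by congr (_, _); rewrite /D; field.
Qed.

Lemma cubic_ofZ k M : k != 0 -> cubic_of (k *: M) = cubic_of M.
Proof.
move=> k0; apply: eq_imagel => u _; apply/cyclic_submodP; exists k => //.
by rewrite scalemxAr.
Qed.
End Cubics.

(** * Jets of curves on a twisted cubic *)

Section Jets.
Variable R : realType.

(** Each F k.+1 is the derivative of F k on one neighbourhood of 0 that does not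
    depend on k, as smoothness near 0 requires. *)
Definition derivative_seq (V : normedModType R) (F : nat -> R -> V) :=
  \forall t \near (0 : R), forall k, is_derive (t : R) 1 (F k) (F k.+1 t).

Lemma derive1n_seq (V : normedModType R) (F : nat -> R -> V) :
  derivative_seq F ->
  \forall t \near (0 : R), forall k,
    derive1n k (F 0%N) t = F k t /\ derivable (derive1n k (F 0%N)) t 1.
Proof.
rewrite /derivative_seq -nbhs_nearE => /nbhs_interior; apply: filterS => t.
pose A := [set t : R | forall k, is_derive (t : R) 1 (F k) (F k.+1 t)].
have E k : forall t, A^° t -> derive1n k (F 0%N) t = F k t.
  elim: k => [|k IHk] {}t At //.
  rewrite derive1nS derive1E.
  have dF := interior_subset At k.
  rewrite -(derive_val (is_derive := dF)); apply: near_eq_derive.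
  by have := nbhs_interior At; apply: filterS => s /IHk.
move=> At k; split; first exact: E.
have dF := interior_subset At k.
apply: near_eq_derivable (ex_derive (is_derive := dF)).
by have := nbhs_interior At; apply: filterS => s /E.
Qed.

Lemma smooth_seq g : @smooth_near0 R g -> derivative_seq (fun k => derive1n k g).
Proof.
apply: filterS => t dg k.
by split; [exact: dg | rewrite derive1nS derive1E].
Qed.

Lemma is_derive_mxP m n (h : R -> 'M[R]_(m, n)) (dh : 'M[R]_(m, n)) (t : R) :
  is_derive t 1 h dh <-> forall i j, is_derive t 1 (fun s => h s i j) (dh i j).
Proof.
split=> [[hd <-] i j|H].
  split; first exact: (derivable_mxP _ _ _).1.
  by rewrite derive_mx // mxE.
have hd : derivable h t 1 by apply/derivable_mxP => i j; case: (H i j).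
split=> //; rewrite derive_mx //; apply/matrixP=> i j; rewrite mxE.
by case: (H i j).
Qed.

Lemma is_derive_lin_comb n (a : 'I_n -> R) (h : 'I_n -> R -> R) (dh : 'I_n -> R) (t : R) :
  (forall i, is_derive t 1 (h i) (dh i)) ->
  is_derive t 1 (fun s => \sum_i h i s * a i) (\sum_i dh i * a i).
Proof.
move=> H; have -> : (fun s => \sum_i h i s * a i) = \sum_i (a i \*: h i).
  by apply/funext => s; rewrite fct_sumE; apply: eq_bigr => i _; exact: mulrC.
have -> : \sum_i dh i * a i = \sum_i a i *: dh i.
  by apply: eq_bigr => i _; exact: mulrC.
by apply: is_derive_sum => i; exact: is_deriveZ.
Qed.

Lemma is_derive_mulmx m n (h : R -> 'rV[R]_m) dh (D : 'M[R]_(m, n)) (t : R) :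
  is_derive t 1 h dh -> is_derive t 1 (fun s => h s *m D) (dh *m D).
Proof.
move=> /is_derive_mxP H; apply/is_derive_mxP => i j; rewrite mxE.
by under eq_fun do rewrite mxE; exact: is_derive_lin_comb.
Qed.

(** The constant coordinate 1 of a homogeneous lift is lost after one derivative. *)
Definition lift_jet (g : R -> 'rV[R]_3) k (t : R) : 'rV[R]_4 :=
  if k is 0 then homog (g t) else row_mx (0 : 'M[R]_1) (derive1n k g t).

Lemma is_derive_row_mx (c : 'M[R]_1) (h : R -> 'rV[R]_3) dh (t : R) :
  is_derive t 1 h dh ->
  is_derive t 1 (fun s => row_mx c (h s) : 'rV[R]_4) (row_mx (0 : 'M[R]_1) dh).
Proof.
move=> /is_derive_mxP H; apply/is_derive_mxP => i j; rewrite mxE.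
under eq_fun do rewrite mxE.
case: (fintype.split _) => k; first by rewrite mxE; exact: is_derive_cst.
exact: H.
Qed.

Lemma lift_jet_seq g (n : nat) (K : 'M[R]_(4, n)) : smooth_near0 g ->
  derivative_seq (fun k t => lift_jet g k t *m K).
Proof.
move=> /smooth_seq; apply: filterS => t H k; apply: is_derive_mulmx.
case: k => [|k]; rewrite /lift_jet /homog; apply: is_derive_row_mx.
exact: (H 0%N).
Qed.

Lemma derive1n_lift g (n : nat) (K : 'M[R]_(4, n)) k : smooth_near0 g ->
  derive1n k (fun t => homog (g t) *m K) 0 = lift_jet g k 0 *m K.
Proof.
by move=> /(lift_jet_seq K)/derive1n_seq/nbhs_singleton/(_ k)[].
Qed.

Lemma derivative_seq_prod (a b c d : nat -> R -> R) :
    derivative_seq a -> derivative_seq b -> derivative_seq c -> derivative_seq d ->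
    (\forall t \near (0 : R), a 0%N t * b 0%N t = c 0%N t * d 0%N t) ->
  a 1%N 0 * b 0%N 0 + a 0%N 0 * b 1%N 0 = c 1%N 0 * d 0%N 0 + c 0%N 0 * d 1%N 0 /\
  a 2%N 0 * b 0%N 0 + 2 * (a 1%N 0 * b 1%N 0) + a 0%N 0 * b 2%N 0
  = c 2%N 0 * d 0%N 0 + 2 * (c 1%N 0 * d 1%N 0) + c 0%N 0 * d 2%N 0.
Proof.
move=> da db dc dd E0.
have dM (f g : nat -> R -> R) i j (t : R) : is_derive t 1 (f i) (f i.+1 t) ->
    is_derive t 1 (g j) (g j.+1 t) ->
    is_derive t 1 (fun t => f i t * g j t) (f i.+1 t * g j t + f i t * g j.+1 t).
  by move=> Hf Hg; apply: is_derive_eq (is_deriveM Hf Hg) _; rewrite addrC mulrC.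
have E1 : \forall t \near (0 : R), a 1%N t * b 0%N t + a 0%N t * b 1%N t =
    c 1%N t * d 0%N t + c 0%N t * d 1%N t.
  near=> t.
  have Ha : forall k, is_derive t 1 (a k) (a k.+1 t) by near: t.
  have Hb : forall k, is_derive t 1 (b k) (b k.+1 t) by near: t.
  have Hc : forall k, is_derive t 1 (c k) (c k.+1 t) by near: t.
  have Hd : forall k, is_derive t 1 (d k) (d k.+1 t) by near: t.
  have := derive_val (is_derive := dM a b 0%N 0%N t (Ha _) (Hb _)).
  have := derive_val (is_derive := dM c d 0%N 0%N t (Hc _) (Hd _)).
  move=> <- <-; apply: near_eq_derive.
  by near: t; apply: nbhs_interior.
split; first exact: (nbhs_singleton E1).
have Ha := nbhs_singleton da; have Hb := nbhs_singleton db.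
have Hc := nbhs_singleton dc; have Hd := nbhs_singleton dd.
have Dl := is_deriveD (dM a b 1%N 0%N 0 (Ha _) (Hb _)) (dM a b 0%N 1%N 0 (Ha _) (Hb _)).
have Dr := is_deriveD (dM c d 1%N 0%N 0 (Hc _) (Hd _)) (dM c d 0%N 1%N 0 (Hc _) (Hd _)).
have := derive_val (is_derive := Dl); rewrite (near_eq_derive _ E1).
rewrite (derive_val (is_derive := Dr)) => E2.
transitivity (a 2%N 0 * b 0%N 0 + a 1%N 0 * b 1%N 0
    + (a 1%N 0 * b 1%N 0 + a 0%N 0 * b 2%N 0)).
  by ring.
by rewrite -E2; ring.
Unshelve. all: by end_near. Qed.

(** The derivatives at 0 of the lift of g in the chart A, in the coordinates in
    which the cubic of M becomes the Veronese curve. *)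
Definition cubic_jet (M A : 'M[R]_4) g k : 'rV[R]_4 :=
  lift_jet g k 0 *m A *m invmx M.

(** The 2-jet of a curve on the Veronese curve at the point (0, 0, 0, 1), obtained
    by differentiating y_0 y_3 = y_1 y_2 and y_1 y_3 = y_2^2.  It holds for every
    parametrization and every chart. *)
Lemma jets_on_cubic (M A : 'M[R]_4) g : M \in unitmx -> A \in unitmx ->
    local_param A (cubic_of M) (cyclic_submod (row o3 M)) g ->
  let y := cubic_jet M A g in
  exists2 w, w != 0 &
    [/\ y 0%N = row4 0 0 0 w, y 1%N 0 o0 = 0, y 1%N 0 o1 = 0, y 2%N 0 o0 = 0
      & y 2%N 0 o1 * w = 2 * y 1%N 0 o2 ^+ 2].
Proof.
move=> uM uA [sg _ g0 Tg _] y.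
have [w w0 yw] := (cyclic_submodP _ _).1 g0.
have y0 : y 0%N = row4 0 0 0 w.
  rewrite /y /cubic_jet /= [_ *m A]yw -scalemxAl.
  have -> : row o3 M *m invmx M = row o3 1%:M by rewrite -row_mul mulmxV.
  by apply: row4P; rewrite !mxE /= ?mulr0 ?mulr1.
exists w => //; pose Y j k t := (lift_jet g k t *m (A *m invmx M)) 0 j.
have dY j : derivative_seq (Y j).
  have := lift_jet_seq (A *m invmx M) sg; apply: filterS => t H k.
  by have /is_derive_mxP := H k; apply.
have YE j k : Y j k 0 = y k 0 j by rewrite /Y /y /cubic_jet mulmxA.
clearbody y.
have Q : \forall t \near (0 : R), on_quadrics (lift_jet g 0%N t *m (A *m invmx M)).
  by apply: filterS Tg => t /(cubic_ofP _ uM)[_]; rewrite -mulmxA.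
have [] := @derivative_seq_prod (Y o0) (Y o3) (Y o1) (Y o2) (dY _) (dY _) (dY _) (dY _).
  by apply: filterS Q => t [].
rewrite !YE !y0 !row4E => a1 a2.
have [] := @derivative_seq_prod (Y o1) (Y o3) (Y o2) (Y o2) (dY _) (dY _) (dY _) (dY _).
  by apply: filterS Q => t [].
rewrite !YE !y0 !row4E => b1 b2.
have y10 : y 1%N 0 o0 = 0.
  by apply: (mulIf w0); move: a1; rewrite !(mul0r, mulr0, addr0).
have y11 : y 1%N 0 o1 = 0.
  by apply: (mulIf w0); move: b1; rewrite !(mul0r, mulr0, addr0).
split=> //.
  by apply: (mulIf w0); move: a2; rewrite y10 y11 !(mul0r, mulr0, addr0).
by move: b2; rewrite y11 !(mul0r, mulr0, addr0, add0r) => ->; rewrite expr2.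
Qed.

(** The first coordinate of the cubic of M is s^3: the plane at infinity osculates
    it at the point of parameter (0, 1), given by the last row of M. *)
Definition affine_normal (M : 'M[R]_4) :=
  [/\ M o0 o0 = 1, M o1 o0 = 0, M o2 o0 = 0 & M o3 o0 = 0].

(** GL_2 acts transitively on the parameters, so that any point of a twisted
    cubic can be given the parameter (0, 1). *)
Lemma twisted_cubic_at T f : twisted_cubic T -> T f ->
  exists2 M : 'M[R]_4, M \in unitmx &
    T = cubic_of M /\ f = cyclic_submod (row o3 M).
Proof.
move=> /twisted_cubicP[M uM ->] [[s t] /= st0 <-].
(* (a, b) is any vector that is independent of (s, t) *)
pose a := if s == 0 then 1 else 0 : R; pose b := if s == 0 then 0 else 1 : R.
have D0 : a * t - b * s != 0.
  rewrite /a /b; have [s0|s0] := eqVneq s 0; last by rewrite mul0r mul1r sub0r oppr_eq0.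
  rewrite mul1r mul0r subr0; apply: contraNneq st0 => ->; by rewrite s0.
exists (sym3 a b s t *m M); first by rewrite unitmx_mul sym3_unit.
rewrite cubic_of_sym3 //; split=> //; rewrite row_mul; congr (cyclic_submod (_ *m _)).
by rewrite /sym3 rowK.
Qed.

(** By [jets_on_cubic] the osculating plane at the point of parameter (0, 1) is the
    plane y_0 = 0 with y = x M^-1; this linear form is then a multiple of x_0. *)
Lemma osculating_affine_normal T :
  twisted_cubic T -> osculating_plane T (@plane_at_infinity R) ->
  exists2 M, M \in unitmx & T = cubic_of M /\ affine_normal M.
Proof.
move=> tT [f Tf [A uA [g gP EE]]].
have [M uM [TE fE]] := twisted_cubic_at tT Tf.
rewrite TE fE in gP; have [w _ [y0 y10 _ y20 _]] := jets_on_cubic uM uA gP.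
have [sg _ _ _ _] := gP.
(* y_0 vanishes on the 2-jet, hence on the plane that the jet spans *)
have inv0 (x : 'rV[R]_4) : x 0 o0 = 0 -> (x *m invmx M) 0 o0 = 0.
  move=> x0; have : plane_at_infinity x.
    by apply: etrans x0; congr (x _ _); apply: val_inj.
  rewrite EE /= => /submxP[c ->]; rewrite -mulmxA mxE big1 // => i _.
  set J := \matrix_(i < 3) _.
  have -> : (J *m invmx M) i o0 = (row i J *m invmx M) 0 o0.
    by rewrite -row_mul [RHS]mxE.
  rewrite rowK /chart_lift derive1n_lift //.
  suff -> : cubic_jet M A g i 0 o0 = 0 by rewrite mulr0.
  move: i => [[|[|[|i]]] lt_i] /=; last by exfalso.
  - by rewrite y0 row4E.
  - exact: y10.
  - exact: y20.
have invc j : j != o0 -> invmx M j o0 = 0.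
  move=> j0; have := inv0 (delta_mx 0 j); rewrite -rowE mxE [row _ _ _ _]mxE.
  by rewrite eq_sym (negPf j0) andbF; apply.
have M0 i : M i o0 * invmx M o0 o0 = (i == o0)%:R.
  have := congr1 (fun X : 'M[R]_4 => X i o0) (mulmxV uM).
  by rewrite !mxE sum4E !(invc o1, invc o2, invc o3) // !mulr0 !addr0.
have inv00 : invmx M o0 o0 != 0.
  by apply: contra_eq_neq (M0 o0) => ->; rewrite mulr0 eq_sym oner_eq0.
exists (invmx M o0 o0 *: M).
  by rewrite unitmxZ // unitfE.
rewrite cubic_ofZ //; split=> //.
by split; rewrite mxE mulrC M0.
Qed.

(** With rows (1, q), (0, a), (0, b), (0, c) for M this says that c is a multiple of
    eps^2, b is nilpotent and b^2 = a c in the algebra. *)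
Definition admissible_coefs (M : 'M[R]_4) :=
  [/\ M o3 o1 = 0, M o3 o2 = 0, M o2 o1 = 0 & M o1 o1 * M o3 o3 = M o2 o2 ^+ 2].

Lemma pt_fE : @pt_f R = cyclic_submod (row4 0 0 0 1).
Proof. by []. Qed.

(** A regular parametrization has a nonzero tangent vector also in projective
    space: the tangent vector of the lift is not a multiple of the point. *)
Lemma lift_jet_neq A g : A \in unitmx -> derive1 g 0 != 0 ->
  forall k, lift_jet g 1 0 *m A != k *: (lift_jet g 0 0 *m A).
Proof.
move=> uA g0 k; apply/eqP; rewrite scalemxAl => /(can_inj (mulmxK uA)).
rewrite /lift_jet homogE row_mx_row4 => /rowP E.
have k0 : k = 0 by have := E o0; rewrite [RHS]mxE !row4E mxE mulr1.
move: g0; rewrite -derive1n1 => /eqP[]; apply: row3P; rewrite [RHS]mxE.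
- by have := E o1; rewrite [RHS]mxE !row4E k0 mul0r.
- by have := E o2; rewrite [RHS]mxE !row4E k0 mul0r.
- by have := E o3; rewrite [RHS]mxE !row4E k0 mul0r.
Qed.

(** Both 2-jets are the same vectors x, x', x'' of R^4, and [jets_on_cubic] applies
    to x itself and to y = x M^-1.  The tangent vector x' = y_2' (0, b) + y_3' (0, c)
    has x_1' = 0 and x_2' != 0, whence b_1 = 0; and w x_1'' = 2 x_2'^2 together with
    x_1'' = a_1 y_1'' gives a_1 c_3 = b_2^2. *)
Lemma contact_admissible_coefs M : M \in unitmx -> affine_normal M ->
  contact 2 (cubic_of M) (cubic_of 1%:M) (@pt_f R) -> admissible_coefs M.
Proof.
move=> uM [M00 M10 M20 M30] [[u u0 uf] _ [A uA [g1 [g2 [lp1 lp2 jet]]]]].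
(* f is the only point of the cubic with s^3 = 0, so u is proportional to (0, 1) *)
have [k k0] := (cyclic_submodP _ _).1 uf.
move=> /rowP E; have := E o0; rewrite vero_mulE M00 M10 M20 M30 !mxE /=.
rewrite !mulr0 !addr0 mulr1 => /eqP; rewrite expf_eq0 /= => /eqP u1.
have u2 : u.2 != 0 by apply: contraNneq u0 => u2; case: u u1 u2 {uf E} => /= ? ? -> ->.
have M3 j : M o3 j = k / u.2 ^+ 3 * row4 0 0 0 1 0 j.
  have := E j; rewrite vero_mulE u1 [RHS]mxE => E'.
  by rewrite mulrAC -E'; field.
have M31 : M o3 o1 = 0 by rewrite M3 row4E mulr0.
have M32 : M o3 o2 = 0 by rewrite M3 row4E mulr0.
have c0 : M o3 o3 != 0 by rewrite M3 row4E mulr1 mulf_neq0 // invr_eq0 expf_neq0.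
have rE : row o3 M = M o3 o3 *: row4 0 0 0 1.
  by apply: row4P; rewrite [LHS]mxE [RHS]mxE ?M30 ?M31 ?M32 row4E ?mulr0 ?mulr1.
have fM : @pt_f R = cyclic_submod (row o3 M).
  by rewrite pt_fE; apply/esym/cyclic_submodP; exists (M o3 o3).
have f1 : @pt_f R = cyclic_submod (row o3 1%:M).
  by congr cyclic_submod; apply: row4P; rewrite !mxE.
have [s1 d1 _ _ _] := lp1.
have jets j : (j <= 2)%N -> lift_jet g2 j 0 = lift_jet g1 j 0.
  by case: j => [|j] lt_j; rewrite /lift_jet ?jet //; have := jet 0%N isT => /= ->.
rewrite f1 in lp2; have [w w0 [x0 x10 x11 x20 x21]] := jets_on_cubic (unitmx1 _ _) uA lp2.
rewrite fM in lp1; have [w' w'0 [y0 y10 y11 y20 y21]] := jets_on_cubic uM uA lp1.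
have xE j : (j <= 2)%N -> cubic_jet 1%:M A g2 j = cubic_jet M A g1 j *m M.
  by move=> lt_j; rewrite /cubic_jet invmx1 mulmx1 jets // mulmxKV.
have := lift_jet_neq uA d1.
have GE j : lift_jet g1 j 0 *m A = cubic_jet M A g1 j *m M.
  by rewrite /cubic_jet mulmxKV.
rewrite !GE; move: x0 x10 x11 x20 x21; rewrite !xE //.
move: (cubic_jet M A g1) y0 y10 y11 y20 y21 => y y0 y10 y11 y20 y21.
have yM j i : (y j *m M) 0 i = y j 0 o0 * M o0 i + y j 0 o1 * M o1 i
    + y j 0 o2 * M o2 i + y j 0 o3 * M o3 i.
  by rewrite [LHS]mxE sum4E.
move=> x0 x10 x11 x20 x21 ind.
have wE : w = w' * M o3 o3.
  by have := congr1 (fun x : 'rV_4 => x 0 o3) x0; rewrite yM y0 !row4E => <-; ring.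
move: x11 x21; rewrite !yM y10 y11 y20 M31 M32 !(mul0r, mulr0, addr0, add0r).
have p0 : y 1%N 0 o2 != 0.
  apply/eqP=> p0; have /eqP[] := ind (y 1%N 0 o3 / w').
  rewrite y0 scalemxAl; congr (_ *m _).
  by apply: row4P; rewrite [RHS]mxE row4E ?mulr0 ?divfK.
move=> /eqP; rewrite mulf_eq0 (negPf p0) /= => /eqP b1.
rewrite b1 mulr0 addr0 => E2; split=> //.
have q0 : 2 * y 1%N 0 o2 ^+ 2 != 0 :> R by rewrite mulf_neq0 ?expf_neq0 ?pnatr_eq0.
apply: (mulfI q0); transitivity (y 2%N 0 o1 * M o1 o1 * w).
  by rewrite -y21 wE; ring.
by rewrite E2; ring.
Qed.
End Jets.

(** * A rational parametrization around f *)

Section Model.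
Variable R : realType.

(** Numerators of the successive derivatives of p / D: the k-th derivative is
    quot_num D p k / D^(k+1). *)
Fixpoint quot_num (D p : {poly R}) k : {poly R} :=
  if k is k'.+1
  then (quot_num D p k')^`()%R * D - (quot_num D p k' * D^`()%R) *+ k'.+1
  else p.

Lemma is_derive_quot (D p : {poly R}) k t : D.[t] != 0 ->
  is_derive t 1 (fun s => (quot_num D p k).[s] / D.[s] ^+ k.+1)
            ((quot_num D p k.+1).[t] / D.[t] ^+ k.+2).
Proof.
move=> Dt; pose q := quot_num D p k.
have Dk : is_derive t 1 (fun s => D.[s] ^+ k.+1) (k.+1%:R * D.[t] ^+ k * D^`()%R.[t]).
  have -> : (fun s => D.[s] ^+ k.+1) = horner (D ^+ k.+1).
    by apply/funext => s; rewrite horner_exp.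
  apply: is_derive_eq (is_derive_poly _ t) _.
  by rewrite deriv_exp hornerMn hornerM horner_exp /= -mulr_natl; ring.
have Dk0 : D.[t] ^+ k.+1 != 0 by rewrite expf_neq0.
have DV : is_derive t 1 (fun s => (D.[s] ^+ k.+1)^-1)
    (- (D.[t] ^+ k.+1) ^- 2 * (k.+1%:R * D.[t] ^+ k * D^`()%R.[t])).
  have [d1 d2] := Dk; split; first exact: derivableV.
  by rewrite deriveV // d2.
apply: is_derive_eq (is_deriveM (is_derive_poly q t) DV) _.
rewrite /= -/q !hornerE hornerMn hornerM /GRing.scale /= -mulr_natl.
rewrite !exprS; field.
by rewrite expf_neq0 // Dt.
Qed.

Lemma deriv_cubic_poly (a b c d : R) :
  (cubic_poly a b c d)^`()%R = cubic_poly b (2 * c) (3 * d) 0.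
Proof.
rewrite /cubic_poly !derivD derivC !derivZ derivX !derivXn /= expr1.
by rewrite -!mul_polyC !polyCM; ring.
Qed.

Lemma quot_num_jet (b c d e f g : R) :
  let q := quot_num (cubic_poly 1 e f g) (cubic_poly 0 b c d) in
  [/\ (q 0%N).[0] = 0, (q 1%N).[0] = b & (q 2%N).[0] = 2 * (c - b * e)].
Proof.
set D := cubic_poly 1 e f g; set p := cubic_poly 0 b c d; move=> q.
have q0 : q 0%N = p by [].
have q1 : q 1%N = p^`()%R * D - p * D^`()%R by rewrite -[RHS]/(_ - _ *+ 1).
have q2 : q 2%N = (q 1%N)^`()%R * D - (q 1%N * D^`()%R) *+ 2 by [].
rewrite q2 q1 q0 derivB !derivM /D /p !deriv_cubic_poly.
by rewrite !(horner_cubic_poly, hornerD, hornerN, hornerMn, hornerM); split; ring.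
Qed.

(** The shape to which a reparametrization brings every admissible cubic: the
    diagonal of the last three rows is scaled to 1, and equal entries h right of it
    make the 2-jet of the parametrization below independent of the parameters. *)
Definition model_mx (r q1 q2 q3 h k : R) : 'M[R]_4 :=
  mx4 (row4 r q1 q2 q3) (row4 0 1 h k) (row4 0 0 1 h) (row4 0 0 0 1).

Lemma upper_tri_unit (M : 'M[R]_4) :
    (forall i j : 'I_4, (j < i)%N -> M i j = 0) -> (forall i, M i i != 0) ->
  M \in unitmx.
Proof.
move=> M0 Md; rewrite unitmxE -det_tr det_trig; last first.
  by apply/is_trig_mxP => i j lt_ij; rewrite mxE M0.
by rewrite unitfE; apply/prodf_neq0 => i _; rewrite mxE.
Qed.

Lemma mx4E (r0 r1 r2 r3 : 'rV[R]_4) j :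
  (mx4 r0 r1 r2 r3 o0 j = r0 0 j) * (mx4 r0 r1 r2 r3 o1 j = r1 0 j) *
  (mx4 r0 r1 r2 r3 o2 j = r2 0 j) * (mx4 r0 r1 r2 r3 o3 j = r3 0 j).
Proof. by rewrite !mxE. Qed.

Lemma model_mx_unit r q1 q2 q3 h k : r != 0 -> model_mx r q1 q2 q3 h k \in unitmx.
Proof.
move=> r0; apply: upper_tri_unit; last first.
  by apply: ord4P; rewrite mx4E row4E ?oner_eq0.
by apply: ord4P; apply: ord4P => // _; rewrite mx4E row4E.
Qed.

(** The affine chart whose origin is f = R(0, 0, 0, 1). *)
Definition rev_mx : 'M[R]_4 :=
  mx4 (row4 0 0 0 1) (row4 0 0 1 0) (row4 0 1 0 0) (row4 1 0 0 0).

Lemma mul_rev_mx a b c d : row4 a b c d *m rev_mx = row4 d c b a.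
Proof. by rewrite mulrow4_mx4; apply: row4P; rewrite !mxE /=; ring. Qed.

Lemma rev_mx_unit : rev_mx \in unitmx.
Proof.
suff /mulmx1_unit[] : rev_mx *m rev_mx = 1%:M by [].
apply/row_matrixP => i; rewrite row_mul row1; move: i.
have [r0 r1 r2 r3] :=
  row_mx4 (row4 0 0 0 1) (row4 0 0 1 0) (row4 0 1 0 0) (row4 (1 : R) 0 0 0).
by apply: ord4P; rewrite (r0, r1, r2, r3) mul_rev_mx; apply: row4P; rewrite row4E mxE.
Qed.

(** In the chart [rev_mx] the cubic of [model_mx] is parametrized by
      (t + h t^2 + q2 t^3, t^2 + q1 t^3, r t^3) / (1 + h t + k t^2 + q3 t^3),
    where t stands for the parameter (t, 1). *)
Definition model_den (h k q3 : R) := cubic_poly 1 h k q3.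
Definition model_num (r q1 q2 h : R) (i : 'I_3) : {poly R} :=
  nth 0 [:: cubic_poly 0 1 h q2; cubic_poly 0 0 1 q1; cubic_poly 0 0 0 r] i.

(** The n-th derivative of this parametrization, and for n = 0 the parametrization
    itself. *)
Definition model_jet (r q1 q2 q3 h k : R) n t : 'rV[R]_3 :=
  \row_i ((quot_num (model_den h k q3) (model_num r q1 q2 h i) n).[t]
          / (model_den h k q3).[t] ^+ n.+1).

Lemma model_vero (r q1 q2 q3 h k t : R) :
  vero (t, 1) *m model_mx r q1 q2 q3 h k =
  row4 (model_num r q1 q2 h i2).[t] (model_num r q1 q2 h i1).[t]
       (model_num r q1 q2 h i0).[t] (model_den h k q3).[t].
Proof.
apply: row4P; rewrite vero_mulE !mx4E !row4E /model_num /model_den /=;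
  by rewrite horner_cubic_poly; ring.
Qed.

Lemma model_homog (r q1 q2 q3 h k t : R) : let D := model_den h k q3 in
  D.[t] != 0 ->
  D.[t] *: (homog (model_jet r q1 q2 q3 h k 0 t) *m rev_mx) =
  vero (t, 1) *m model_mx r q1 q2 q3 h k.
Proof.
move=> D Dt; rewrite homogE mul_rev_mx model_vero.
apply: row4P; rewrite [LHS]mxE !row4E ?mxE ?mulr1 //.
all: by rewrite expr1 mulrC divfK.
Qed.

Lemma entry_continuous (n : nat) (K : 'M[R]_(4, n)) j :
  continuous (fun x : 'rV[R]_3 => (homog x *m K) 0 j).
Proof.
have -> : (fun x : 'rV[R]_3 => (homog x *m K) 0 j) =
    (fun x => K o0 j + x 0 i0 * K o1 j + x 0 i1 * K o2 j + x 0 i2 * K o3 j).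
  by apply/funext => x; rewrite homogE mulrow4 !mxE mul1r.
have ci (i : 'I_3) c : continuous (fun x : 'rV[R]_3 => x 0 i * c).
  by move=> x; apply: continuousM; [exact: coord_continuous | exact: cst_continuous].
have cD (f g : 'rV[R]_3 -> R) : continuous f -> continuous g ->
    continuous (fun x => f x + g x).
  by move=> cf cg x; exact: cvgD (cf x) (cg x).
by do 3 (apply: (cD); last exact: ci); exact: cst_continuous.
Qed.

(** The local inverse of the parametrization is y_2 / y_3 with y = x N^-1, which is
    continuous in x near f; this is why the points of the cubic near f are covered
    by small parameters. *)
Lemma model_local_param r q1 q2 q3 h k : r != 0 ->
  let g := model_jet r q1 q2 q3 h k 0 in
  local_param rev_mx (cubic_of (model_mx r q1 q2 q3 h k)) (@pt_f R) g /\
  [/\ derive1n 0 g 0 = 0, derive1n 1 g 0 = \row_(i < 3) [:: 1; 0; 0]`_i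
    & derive1n 2 g 0 = \row_(i < 3) [:: 0; 2; 0]`_i].
Proof.
move=> r0 g; set D := model_den h k q3; set N := model_mx r q1 q2 q3 h k.
have uN : N \in unitmx by exact: model_mx_unit.
have D00 : D.[0] = 1 by rewrite horner_cubic_poly !expr0n /= !mulr0 !addr0.
have D0 : \forall t \near (0 : R), D.[t] != 0.
  by apply: (cvgr_neq0 _ (@continuous_horner _ D 0)); rewrite D00 oner_eq0.
have seq : derivative_seq (model_jet r q1 q2 q3 h k).
  apply: filterS D0 => t Dt n; apply/is_derive_mxP => i j.
  by under eq_fun do rewrite mxE; rewrite mxE; exact: is_derive_quot.
have gE n : derive1n n g 0 = model_jet r q1 q2 q3 h k n 0.
  by have /derive1n_seq/nbhs_singleton/(_ n)[] := seq.
have jets : [/\ derive1n 0 g 0 = 0, derive1n 1 g 0 = \row_(i < 3) [:: 1; 0; 0]`_i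
    & derive1n 2 g 0 = \row_(i < 3) [:: 0; 2; 0]`_i].
  have J n j : model_jet r q1 q2 q3 h k n 0 0 j =
      (quot_num D (model_num r q1 q2 h j) n).[0].
    by rewrite mxE -/D D00 expr1n divr1.
  have [a0 a1 a2] := quot_num_jet 1 h q2 h k q3.
  have [b0 b1 b2] := quot_num_jet 0 1 q1 h k q3.
  have [c0 c1 c2] := quot_num_jet 0 0 r h k q3.
  rewrite !gE; split; apply: row3P; rewrite J mxE.
  - exact: a0.
  - exact: b0.
  - exact: c0.
  - exact: a1.
  - exact: b1.
  - exact: c1.
  - by rewrite [LHS]a2 /=; ring.
  - by rewrite [LHS]b2 /=; ring.
  - by rewrite [LHS]c2 /=; ring.
split=> //; case: jets => g0 g1 g2.
have lift_g t : D.[t] != 0 ->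
    cubic_of N (chart_pt rev_mx (g t)) /\
    chart_pt rev_mx (g t) = cyclic_submod (vero (t, 1) *m N).
  move=> Dt.
  have E : chart_pt rev_mx (g t) = cyclic_submod (vero (t, 1) *m N).
    apply/esym/cyclic_submodP; exists D.[t] => //.
    by rewrite /chart_lift model_homog.
  by split=> //; rewrite E; exists (t, 1) => //=; rewrite xpair_eqE oner_eq0 andbF.
split.
- by apply: filterS (derive1n_seq seq) => t H n; case: (H n).
- rewrite -derive1n1 g1; apply/eqP => /rowP/(_ i0)/eqP.
  by rewrite !mxE oner_eq0.
- have [] := lift_g 0; first by rewrite D00 oner_eq0.
  move=> _ ->; rewrite pt_fE; congr cyclic_submod.
  by rewrite model_vero -/D D00; congr row4; rewrite horner_cubic_poly; ring.
- by apply: filterS D0 => t /lift_g[].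
- move=> U U0.
  pose y x := homog x *m (rev_mx *m invmx N).
  have yc j : {for g 0, continuous (fun x => y x 0 j)} by exact: entry_continuous.
  have yg0 : y (g 0) = row4 0 0 0 1.
    rewrite /y mulmxA; have := @model_homog r q1 q2 q3 h k 0.
    rewrite /= -/D D00 oner_eq0 => /(_ isT); rewrite scale1r => ->.
    by rewrite mulmxK //; apply: row4P; rewrite !row4E /=; ring.
  have y3 : \forall x \near g 0, y x 0 o3 != 0.
    by apply: (cvgr_neq0 _ (yc o3)); rewrite yg0 row4E oner_eq0.
  have ys : \forall x \near g 0, (U `&` [set t | D.[t] != 0]) (y x 0 o2 / y x 0 o3).
    have c : {for g 0, continuous (fun x => y x 0 o2 / y x 0 o3)}.
      apply: continuousM; first exact: yc.
      by apply: continuousV; [rewrite yg0 row4E oner_eq0 | exact: yc].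
    apply: c => /=; rewrite yg0 !row4E mul0r.
    by apply: filterI.
  near=> x => Tx.
  have y3x : y x 0 o3 != 0 by near: x.
  have [Us Ds] : (U `&` [set t | D.[t] != 0]) (y x 0 o2 / y x 0 o3) by near: x.
  exists (y x 0 o2 / y x 0 o3) => //.
  have [_ [_ e2 e3]] := (cubic_ofP _ uN).1 Tx.
  rewrite -mulmxA in e2 e3.
  set s := y x 0 o2 / y x 0 o3.
  have yE : y x = y x 0 o3 *: vero (s, 1).
    have y1 : y x 0 o1 = y x 0 o2 ^+ 2 / y x 0 o3 by rewrite expr2 -e2 mulfK.
    have y0 : y x 0 o0 = y x 0 o2 ^+ 3 / y x 0 o3 ^+ 2.
      by apply: (mulIf y3x); rewrite [LHS]e3 [X in X * _]y1; field.
    by apply: row4P; rewrite [RHS]mxE row4E /= ?y0 ?y1 /s; field.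
  have := congr1 (mulmx^~ N) yE.
  rewrite -scalemxAl -model_homog // /y !mulmxA mulmxKV //.
  rewrite scalerA scalemxAl => /(can_inj (mulmxK rev_mx_unit)).
  rewrite !homogE => /rowP E.
  have := E o0; rewrite [RHS]mxE !row4E mulr1 => c1.
  apply: row3P.
  + by have := E o1; rewrite [RHS]mxE !row4E -c1 mul1r.
  + by have := E o2; rewrite [RHS]mxE !row4E -c1 mul1r.
  + by have := E o3; rewrite [RHS]mxE !row4E -c1 mul1r.
Unshelve. all: by end_near. Qed.

Lemma model_contact r q1 q2 q3 h k : r != 0 ->
  contact 2 (cubic_of (model_mx r q1 q2 q3 h k)) (cubic_of 1%:M) (@pt_f R).
Proof.
move=> r0; have -> : 1%:M = model_mx 1 0 0 0 0 0.
  by apply/row_matrixP; apply: ord4P; rewrite row1; apply: row4P; rewrite !mxE.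
have f_in a b c d e f : a != 0 -> cubic_of (model_mx a b c d e f) (@pt_f R).
  move=> a0; exists (0, 1); first by rewrite /= xpair_eqE oner_eq0 andbF.
  rewrite model_vero pt_fE; congr cyclic_submod.
  by congr row4; rewrite horner_cubic_poly; ring.
split; [exact: f_in | by apply: f_in; rewrite oner_eq0 | exists rev_mx].
  exact: rev_mx_unit.
have [lp1 [a0 a1 a2]] := model_local_param q1 q2 q3 h k r0.
have [lp2 [b0 b1 b2]] := model_local_param 0 0 0 0 0 (oner_neq0 R).
exists (model_jet r q1 q2 q3 h k 0), (model_jet 1 0 0 0 0 0 0); split=> //.
case=> [|[|[|j]]] lt_j; last by exfalso.
- by rewrite a0 b0.
- by rewrite a1 b1.
- by rewrite a2 b2.
Qed.

End Model.

(** * The algebra R[X]/(X^3) and its chains *)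

Section Chains.
Variable R : realType.
Local Notation L := (Lalg R).
Implicit Types (z w : L).

Definition coefL z i : R := (z : {poly R})`_i.

Lemma rmodp_Xn_coef (p d : {poly R}) n i : d = 'X^n -> (i < n)%N ->
  (Pdiv.Ring.rmodp p d)`_i = p`_i.
Proof.
move=> -> lt_in; rewrite [in RHS](Pdiv.RingMonic.rdivp_eq (monicXn _ n) p).
by rewrite coefD coefMXn lt_in add0r.
Qed.

Lemma coefLM z w i : (i < 3)%N ->
  coefL (z * w) i = \sum_(j < i.+1) coefL z j * coefL w (i - j).
Proof.
move=> lt_i3; rewrite /coefL poly_of_qpolyM.
by rewrite (rmodp_Xn_coef _ (mk_monic_Xn _ 3)) // coefM.
Qed.

Lemma coefLM0 z w : coefL (z * w) 0 = coefL z 0 * coefL w 0.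
Proof. by rewrite coefLM // big_ord1. Qed.

Lemma coefLM1 z w : coefL (z * w) 1 = coefL z 0 * coefL w 1 + coefL z 1 * coefL w 0.
Proof. by rewrite coefLM // !big_ord_recl big_ord0 addr0. Qed.

Lemma coefLM2 z w :
  coefL (z * w) 2 = coefL z 0 * coefL w 2 + coefL z 1 * coefL w 1 + coefL z 2 * coefL w 0.
Proof. by rewrite coefLM // !big_ord_recl big_ord0 addr0 addrA. Qed.

Lemma coefLD z w i : coefL (z + w) i = coefL z i + coefL w i.
Proof. by rewrite /coefL poly_of_qpolyD coefD. Qed.

Lemma coefLZ (a : R) z i : coefL (a *: z) i = a * coefL z i.
Proof. by rewrite /coefL poly_of_qpolyZ coefZ. Qed.

Lemma coefL1 i : coefL 1 i = (i == 0%N)%:R.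
Proof. by rewrite /coefL /= coefC; case: eqP. Qed.

Lemma coefLN z i : coefL (- z) i = - coefL z i.
Proof. by rewrite -scaleN1r coefLZ mulN1r. Qed.

Lemma coefL0 i : coefL 0 i = 0.
Proof. by rewrite -(scale0r 1) coefLZ mul0r. Qed.

Lemma coefL_eps i : (i < 3)%N -> coefL (eps R) i = (i == 1%N)%:R.
Proof.
move=> lt_i; rewrite /coefL /eps /=.
by rewrite (rmodp_Xn_coef _ (mk_monic_Xn _ 3)) // coefX.
Qed.

Lemma coefLP z w : coefL z 0 = coefL w 0 -> coefL z 1 = coefL w 1 ->
  coefL z 2 = coefL w 2 -> z = w.
Proof.
move=> e0 e1 e2; apply/npolyP => i.
have [lt_i|ge_i] := ltnP i 3.
  by move: i lt_i => [|[|[|]]].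
have szX : (size (mk_monic ('X^3 : {poly R}))).-1 = 3%N.
  by rewrite mk_monic_Xn size_polyXn.
by rewrite !big_coef_npoly // szX.
Qed.

Definition Lalg_of (a b c : R) : L := a%:A + b *: eps R + c *: eps R ^+ 2.

Definition coefLE := (coefLM0, coefLM1, coefLM2, coefLD, coefLZ, coefLN, coefL1, coefL0,
  @coefL_eps 0 isT, @coefL_eps 1 isT, @coefL_eps 2 isT, eqxx).

Lemma coefL_of a b c :
  (coefL (Lalg_of a b c) 0 = a) * (coefL (Lalg_of a b c) 1 = b) *
  (coefL (Lalg_of a b c) 2 = c).
Proof. by rewrite /Lalg_of expr2 !coefLE /=; do !split; ring. Qed.

Lemma unit_Lalg z : (z \is a GRing.unit) = (coefL z 0 != 0).
Proof.
apply/idP/idP => [uz|z0].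
  have := congr1 (coefL^~ 0) (divrr uz); rewrite /= coefLM0 coefL1 eqxx => E.
  by apply: contra_eq_neq E => ->; rewrite mul0r eq_sym oner_eq0.
pose w := Lalg_of (coefL z 0)^-1 (- coefL z 1 / coefL z 0 ^+ 2)
  (coefL z 1 ^+ 2 / coefL z 0 ^+ 3 - coefL z 2 / coefL z 0 ^+ 2).
suff zw : w * z = 1 by apply/unitrP; exists w; rewrite [z * w]mulrC.
by apply: coefLP; rewrite !(coefLM0, coefLM1, coefLM2, coefL_of, coefL1) /=; field.
Qed.

Lemma sum2E (V : nmodType) (F : 'I_2 -> V) : \sum_i F i = F 0 + F 1.
Proof.
by rewrite !big_ord_recl big_ord0 addr0; congr (_ + F _); apply: val_inj.
Qed.

Definition real_chain (G : 'M[L]_2) : set (set 'rV[L]_2) :=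
  [set [set v *m G | v in S] | S in @real_line R].

(** The point of the chain with real parameters (x, y) is proper when the second
    coordinate of (x, y) G is a unit, and then it is the quotient of the two
    coordinates. *)
Lemma proper_real_chainP (G : 'M[L]_2) z :
  proper_part (real_chain G) z <-> exists x y : R, [/\ (x, y) != (0, 0),
    x *: G 0 1 + y *: G 1 1 \is a GRing.unit &
    z * (x *: G 0 1 + y *: G 1 1) = x *: G 0 0 + y *: G 1 0].
Proof.
set p := \row_(i < 2) [:: z; 1]`_i.
have vG (v : 'rV[R]_2) j : (map_mx (fun x : R => x%:A : L) v *m G) 0 j =
    v 0 0 *: G 0 j + v 0 1 *: G 1 j.
  by rewrite mxE sum2E !mxE !mulr_algl.
have memG (v : 'rV[L]_2) : [set u *m G | u in cyclic_submod v] = cyclic_submod (v *m G).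
  apply/seteqP; split=> [_ [_ [a _ <-] <-]|_ [a _ <-]].
    by exists a => //; rewrite scalemxAl.
  by exists (a *: v); [exists a | rewrite scalemxAl].
have ord2 (P : 'I_2 -> Prop) : P 0 -> P 1 -> forall i, P i.
  move=> P0 P1 [[|[|//]] lt_i].
    by move: P0; congr (P _); apply: val_inj.
  by move: P1; congr (P _); apply: val_inj.
split=> [[_ [v vP <-]]|[x [y [xy0 uw zw]]]]; rewrite ?memG.
  rewrite -/p => E; exists (v 0 0), (v 0 1).
  have [a _ pE] : cyclic_submod (map_mx (fun x : R => x%:A : L) v *m G) p.
    by rewrite E; exists 1; rewrite ?scale1r.
  have z1 : a * (v 0 0 *: G 0 1 + v 0 1 *: G 1 1) = 1.
    by have := congr1 (fun X : 'rV_2 => X 0 1) pE; rewrite [LHS]mxE vG mxE.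
  have z0 : a * (v 0 0 *: G 0 0 + v 0 1 *: G 1 0) = z.
    by have := congr1 (fun X : 'rV_2 => X 0 0) pE; rewrite [LHS]mxE vG mxE.
  split.
  - apply/eqP => -[v0 v1]; move: z1; rewrite v0 v1 !scale0r addr0 mulr0 => /eqP.
    by rewrite eq_sym oner_eq0.
  - by apply/unitrP; exists a; rewrite z1 mulrC z1.
  - by rewrite -z0 mulrAC z1 mul1r.
pose v : 'rV[R]_2 := \row_(i < 2) [:: x; y]`_i.
have v0 : v 0 0 = x by rewrite mxE.
have v1 : v 0 1 = y by rewrite mxE.
exists (cyclic_submod (map_mx (fun x : R => x%:A : L) v)).
  exists v => //=; exists v => //=; rewrite v0 v1 !unitfE.
  by move: xy0; rewrite xpair_eqE negb_and => /orP.
rewrite memG -/p; set w := x *: G 0 1 + y *: G 1 1 in uw zw.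
have -> : map_mx (fun x : R => x%:A : L) v *m G = w *: p.
  apply/rowP; apply: ord2; rewrite vG v0 v1 !mxE /=; last by rewrite mulr1.
  by rewrite mulrC zw.
apply/seteqP; split=> _ [a _ <-].
  by exists (a * w) => //; rewrite scalerA.
by exists (a / w) => //; rewrite scalerA divrK.
Qed.

Lemma det2E (K : comNzRingType) (G : 'M[K]_2) :
  \det G = G 0 0 * G 1 1 - G 0 1 * G 1 0.
Proof.
have E : lift ord0 ord0 = 1 :> 'I_2 by apply: val_inj.
have E0 : lift 1 ord0 = 0 :> 'I_2 by apply: val_inj.
rewrite (expand_det_row _ 0) sum2E /cofactor !det_mx11 !mxE E E0 /=.
by rewrite expr0 expr1; ring.
Qed.

(** The expansion of be + al t (1 + ga t)^-1 for ga^3 = 0. *)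
Definition chain_curve (al be ga : L) (t : R) : L :=
  be + t *: al - t ^+ 2 *: (al * ga) + t ^+ 3 *: (al * ga ^+ 2).

Lemma cube_eq0 (ga : L) : coefL ga 0 = 0 -> ga ^+ 3 = 0.
Proof.
by move=> g0; apply: coefLP; rewrite exprS expr2 !coefLE g0; ring.
Qed.

Lemma chain_curveP (al be ga z : L) (t : R) : coefL ga 0 = 0 ->
  z * (t *: ga + 1) = t *: (al + be * ga) + be <-> z = chain_curve al be ga t.
Proof.
move=> /cube_eq0 g3.
pose T : L := t%:A.
have sT (x : L) : t *: x = T * x by rewrite mulr_algl.
have sTn n (x : L) : t ^+ n *: x = T ^+ n * x.
  by rewrite -mulr_algl; congr (_ * _); rewrite /T exprZn expr1n.
have u1 : (T * ga + 1) * (1 - T * ga + T ^+ 2 * ga ^+ 2) = 1.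
  have -> : (T * ga + 1) * (1 - T * ga + T ^+ 2 * ga ^+ 2) = 1 + T ^+ 3 * ga ^+ 3 by ring.
  by rewrite g3 mulr0 addr0.
have cE : chain_curve al be ga t =
    (T * (al + be * ga) + be) * (1 - T * ga + T ^+ 2 * ga ^+ 2).
  transitivity (chain_curve al be ga t + T ^+ 3 * be * ga ^+ 3).
    by rewrite g3 mulr0 addr0.
  by rewrite /chain_curve sT !sTn; ring.
rewrite cE !sT; split=> [<-|->]; first by rewrite -mulrA u1 mulr1.
by rewrite -mulrA [X in _ * X]mulrC u1 mulr1.
Qed.

(** The matrix with rows (al + be ga, ga), (be, 1) has determinant al and maps the
    parameters (t, 1) to be + al t (1 + ga t)^-1. *)
Lemma chain_of_curve (al be ga : L) : coefL al 0 != 0 -> coefL ga 0 = 0 ->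
  exists2 C, chain C & proper_part C = range (chain_curve al be ga).
Proof.
move=> al0 ga0.
pose G : 'M[L]_2 := \matrix_(i < 2, j < 2)
  (nth [::] [:: [:: al + be * ga; ga]; [:: be; 1]] i)`_j.
have uG : G \in unitmx.
  rewrite unitmxE det2E !mxE /= unit_Lalg.
  by rewrite mulr1 [be * ga]mulrC addrK.
exists (real_chain G); first by exists G.
apply/seteqP; split=> [z /proper_real_chainP[x [y [xy0]]]|_ [t _ <-]].
  rewrite !mxE /= unit_Lalg !coefLE ga0 mulr0 add0r mulr1 => y0 zE.
  exists (x / y) => //; apply/esym/chain_curveP => //.
  have := congr1 (fun u => y^-1 *: u) zE.
  by rewrite /= scalerAr !scalerDr !scalerA mulVf // !scale1r [y^-1 * x]mulrC.
apply/proper_real_chainP; exists t, 1; split.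
- by rewrite xpair_eqE oner_eq0 andbF.
- by rewrite !mxE /= unit_Lalg !coefLE ga0 mulr0 add0r mulr1 oner_eq0.
- by rewrite !mxE /= !scale1r; apply/chain_curveP.
Qed.

(** The second column of G is not zero modulo the maximal ideal, so exactly one real
    parameter is mapped to a nonproper point.  Moving this parameter to infinity
    and dividing by the second coordinate of the other basis vector brings the
    chain to the form of [chain_curve]. *)
Lemma chain_curve_ex C : chain C -> exists al be ga, [/\ coefL al 0 != 0, coefL ga 0 = 0
  & proper_part C = range (chain_curve al be ga)].
Proof.
move=> [G uG ->]; rewrite -/(real_chain G).
set r0 := coefL (G 0 1) 0; set r1 := coefL (G 1 1) 0.
have dG : coefL (G 0 0 * G 1 1 - G 0 1 * G 1 0) 0 != 0.
  by rewrite -det2E -unit_Lalg -unitmxE.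
pose n := r0 ^+ 2 + r1 ^+ 2.
have n0 : n != 0.
  apply: contraNneq dG => /eqP; rewrite paddr_eq0 ?sqr_ge0 // !sqrf_eq0.
  move=> /andP[/eqP r00 /eqP r10].
  by rewrite !coefLE -/r0 -/r1 r00 r10 mulr0 mul0r subrr.
(* mixN is the image of (r1, -r0), the real parameter of the nonproper point, and
   mixR that of a parameter at which the second coordinate has real part 1 *)
pose mixR j := (r0 / n) *: G 0 j + (r1 / n) *: G 1 j.
pose mixN j := r1 *: G 0 j - r0 *: G 1 j.
have d1 : coefL (mixR 1) 0 = 1 by rewrite /mixR !coefLE -/r0 -/r1 /n; field.
have ud : mixR 1 \is a GRing.unit by rewrite unit_Lalg d1 oner_eq0.
have g1 : coefL (mixN 1) 0 = 0 by rewrite /mixN !coefLE -/r0 -/r1; ring.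
pose ga := mixN 1 / mixR 1; pose be := mixR 0 / mixR 1.
pose al := mixN 0 / mixR 1 - be * ga.
have ga0 : coefL ga 0 = 0 by rewrite coefLM0 g1 mul0r.
have alE : al * mixR 1 ^+ 2 = G 0 0 * G 1 1 - G 0 1 * G 1 0.
  rewrite /al mulrBl expr2.
  have -> : mixN 0 / mixR 1 * (mixR 1 * mixR 1) = mixN 0 * mixR 1.
    by rewrite mulrA divrK.
  have -> : be * ga * (mixR 1 * mixR 1) = mixR 0 * mixN 1.
    by rewrite /be /ga mulrACA !divrK.
  rewrite /mixN /mixR; apply: coefLP; rewrite !coefLE -/r0 -/r1 /n; field; exact: n0.
have al0 : coefL al 0 != 0.
  by apply: contraNneq dG => al0; rewrite -alE coefLM0 al0 mul0r.
exists al, be, ga; split=> //.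
have cc t z : z = chain_curve al be ga t <->
    z * (t *: mixN 1 + mixR 1) = t *: mixN 0 + mixR 0.
  rewrite -chain_curveP // subrK.
  have E1 : t *: mixN 1 + mixR 1 = (t *: ga + 1) * mixR 1.
    by rewrite mulrDl mul1r -scalerAl divrK.
  have E0 : t *: mixN 0 + mixR 0 = (t *: (mixN 0 / mixR 1) + be) * mixR 1.
    by rewrite mulrDl -scalerAl !divrK.
  rewrite E1 E0 mulrA; split=> [-> //|]; exact: (mulIr ud).
have mixE t j : t *: mixN j + mixR j =
    (t * r1 + r0 / n) *: G 0 j + (r1 / n - t * r0) *: G 1 j.
  rewrite /mixN /mixR scalerBr !scalerA !scalerDl scaleNr.
  by ring.
apply/seteqP; split=> [z /proper_real_chainP[x [y [xy0]]]|_ [t _ <-]].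
  rewrite unit_Lalg !coefLE -/r0 -/r1 => s0 zE.
  set s := x * r0 + y * r1 in s0.
  exists ((x * r1 - y * r0) / n / s) => //; apply/esym/cc; rewrite !mixE.
  have tE : (x * r1 - y * r0) / n / s * r1 + r0 / n = x / s.
    by rewrite /n /s; field; rewrite -/n -/s n0 s0.
  have uE : r1 / n - (x * r1 - y * r0) / n / s * r0 = y / s.
    by rewrite /n /s; field; rewrite -/n -/s n0 s0.
  rewrite tE uE; have := congr1 (fun u => s^-1 *: u) zE.
  by rewrite /= scalerAr !scalerDr !scalerA ![s^-1 * _]mulrC.
apply/proper_real_chainP; exists (t * r1 + r0 / n), (r1 / n - t * r0).
have E : coefL (t *: mixN 1 + mixR 1) 0 = 1 by rewrite coefLD coefLZ g1 d1 mulr0 add0r.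
rewrite -!mixE; split.
- apply/eqP=> -[e0 e1]; move/eqP: E.
  by rewrite mixE e0 e1 !scale0r addr0 coefL0 eq_sym oner_eq0.
- by rewrite unit_Lalg E oner_eq0.
- exact/cc.
Qed.
End Chains.

(** * Admissible cubic parabolas *)

Section Main.
Variable R : realType.
Local Notation L := (Lalg R).
Implicit Types (z : L) (M N : 'M[R]_4).

Lemma admissible_coefs_diag M : M \in unitmx -> affine_normal M -> admissible_coefs M ->
  [/\ M o1 o1 != 0, M o2 o2 != 0 & M o3 o3 != 0].
Proof.
move=> uM [_ M10 M20 M30] [M31 M32 M21 _].
have tri : is_trig_mx M^T.
  apply/is_trig_mxP => i j; rewrite mxE; move: i j.
  by apply: ord4P; apply: ord4P.
have := uM; rewrite unitmxE -det_tr det_trig // unitfE => /prodf_neq0 D.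
by split; [have := D o1 isT | have := D o2 isT | have := D o3 isT]; rewrite mxE.
Qed.

(** The parameter change t |-> la t + mu multiplies the diagonal entries a_1, b_2, c_3
    by la, la^2, la^3; the equation a_1 c_3 = b_2^2 makes them equal, to ka, for
    la = b_2 / c_3.  The shift mu is then determined by equating the two entries
    right of the diagonal. *)
Lemma admissible_coefs_model M : M \in unitmx -> affine_normal M -> admissible_coefs M ->
  exists r q1 q2 q3 h k, r != 0 /\ cubic_of M = cubic_of (model_mx r q1 q2 q3 h k).
Proof.
move=> uM aM tM; have [a0 b0 c0] := admissible_coefs_diag uM aM tM.
have [M00 M10 M20 M30] := aM; have [M31 M32 M21 E] := tM.
pose la := M o2 o2 / M o3 o3; pose ka := la ^+ 3 * M o3 o3.
pose mu := (M o1 o2 - la * M o2 o3) / M o2 o2.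
have la0 : la != 0 by rewrite mulf_neq0 ?invr_eq0.
have ka0 : ka != 0 by rewrite mulf_neq0 ?expf_neq0.
pose q j := (M o0 j + mu * M o1 j + mu ^+ 2 * M o2 j + mu ^+ 3 * M o3 j) / ka.
pose d j := la * (M o1 j + 2 * mu * M o2 j + 3 * mu ^+ 2 * M o3 j) / ka.
exists ka^-1, (q o1), (q o2), (q o3), (d o2), (d o3); split; first by rewrite invr_eq0.
have D0 : 1 * la - mu * 0 != 0 by rewrite mul1r mulr0 subr0.
rewrite -(cubic_of_sym3 M D0) -(cubic_ofZ _ (invr_neq0 ka0)); congr cubic_of.
have aE : M o1 o1 = M o2 o2 ^+ 2 / M o3 o3 by rewrite -E mulfK.
apply: vero_inj => t; rewrite -scalemxAr mulmxA vero_sym3.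
apply: row4P; rewrite [LHS]mxE !vero_mulE !mx4E !row4E /q /d /= ?M00 ?M10 ?M20 ?M30.
- by field.
- rewrite M21 M31 aE /ka /mu /la; field; exact/andP.
- rewrite M32 /ka /mu /la; field; exact/andP.
- rewrite M32 /ka /mu /la; field; exact/andP.
Qed.

Definition aff_row z : 'rV[R]_4 := row4 1 (coefL z 0) (coefL z 1) (coefL z 2).

Lemma affine_embedE z : affine_embed z = cyclic_submod (aff_row z).
Proof. by rewrite /affine_embed homogE !mxE. Qed.

Lemma aff_row_inj : injective aff_row.
Proof.
move=> z w /rowP E; apply: coefLP.
- by have := E o1; rewrite !row4E.
- by have := E o2; rewrite !row4E.
- by have := E o3; rewrite !row4E.
Qed.

Definition affine_part (T : set (set 'rV[R]_4)) : set L := @affine_embed R @^-1` T.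

Definition row_Lalg M i : L := Lalg_of (M i o1) (M i o2) (M i o3).

Definition mx_curve M (t : R) : L :=
  row_Lalg M o0 + t *: row_Lalg M o1 + t ^+ 2 *: row_Lalg M o2 + t ^+ 3 *: row_Lalg M o3.

Lemma coefL_mx_curve M t :
  let p j := M o0 j + t * M o1 j + t ^+ 2 * M o2 j + t ^+ 3 * M o3 j in
  [/\ coefL (mx_curve M t) 0 = p o1, coefL (mx_curve M t) 1 = p o2
    & coefL (mx_curve M t) 2 = p o3].
Proof.
rewrite /mx_curve; have F0 i : coefL (row_Lalg M i) 0 = M i o1 by rewrite coefL_of.
have F1 i : coefL (row_Lalg M i) 1 = M i o2 by rewrite coefL_of.
have F2 i : coefL (row_Lalg M i) 2 = M i o3 by rewrite coefL_of.
move: (row_Lalg M) F0 F1 F2 => f F0 F1 F2.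
by rewrite !(coefLD, coefLZ) !F0 !F1 !F2.
Qed.

Lemma aff_row_curve M t : affine_normal M -> aff_row (mx_curve M t) = vero (1, t) *m M.
Proof.
move=> [M00 M10 M20 M30]; have [e1 e2 e3] := coefL_mx_curve M t.
apply: row4P; rewrite row4E vero_mulE ?M00 ?M10 ?M20 ?M30 ?e1 ?e2 ?e3 /=; by ring.
Qed.

Lemma vero1_neq0 (t : R) : (1, t) != (0, 0) :> R * R.
Proof. by rewrite xpair_eqE oner_eq0. Qed.

Lemma affine_part_cubic M : M \in unitmx -> affine_normal M ->
  affine_part (cubic_of M) = range (mx_curve M).
Proof.
move=> uM aM; apply/seteqP; split=> [z|_ [t _ <-]]; rewrite /affine_part /preimage /=.
  rewrite affine_embedE => -[u u0 /esym/cyclic_submodP[k k0 zE]].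
  have [M00 M10 M20 M30] := aM.
  have := congr1 (fun x : 'rV_4 => x 0 o0) zE.
  rewrite [RHS]mxE row4E vero_mulE M00 M10 M20 M30 => E.
  have u1 : u.1 != 0.
    by apply: contra_eq_neq E => ->; rewrite !(mulr0, mul0r, addr0, expr0n, oner_eq0).
  exists (u.2 / u.1) => //; apply: aff_row_inj; rewrite aff_row_curve // zE.
  have -> : vero u = u.1 ^+ 3 *: vero (1, u.2 / u.1).
    by rewrite -veroZ mulr1 mulrC divfK //; case: u {u0 zE E u1}.
  rewrite -scalemxAl scalerA; suff -> : k * u.1 ^+ 3 = 1 by rewrite scale1r.
  by rewrite E; ring.
rewrite affine_embedE aff_row_curve //.
by exists (1, t) => //; exact: vero1_neq0.
Qed.

Lemma vero_classes_inj M (m n : nat) : M \in unitmx -> affine_normal M ->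
  cyclic_submod (vero (1, m%:R) *m M) = cyclic_submod (vero (1, n%:R) *m M) -> m = n.
Proof.
move=> uM aM /cyclic_submodP[k k0 E].
have := congr1 (mulmx^~ (invmx M)) E; rewrite -scalemxAl !mulmxK // => /rowP {}E.
have := E o0; rewrite [RHS]mxE !row4E /= expr1n mulr1 => k1.
have := E o1; rewrite [RHS]mxE !row4E /= expr1n -k1 !mul1r.
exact: natr_inj.
Qed.

Lemma twisted_cubic_eq_of_affine M T : M \in unitmx -> affine_normal M ->
  twisted_cubic T -> (forall n, T (affine_embed (mx_curve M n%:R))) -> T = cubic_of M.
Proof.
move=> uM aM /twisted_cubicP[N uN ->] NM.
apply: (@cubic_of_eq _ _ _ (fun n => vero (1, n%:R) *m M)) => // [m n|n|n].
- exact: vero_classes_inj.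
- by have := NM n; rewrite affine_embedE aff_row_curve.
- by exists (1, n%:R) => //; exact: vero1_neq0.
Qed.

Lemma twisted_cubic_of M : M \in unitmx -> twisted_cubic (cubic_of M).
Proof. by move=> uM; apply/twisted_cubicP; exists M. Qed.

Lemma projective_extensionE M : M \in unitmx -> affine_normal M ->
  projective_extension (affine_part (cubic_of M)) = cubic_of M.
Proof.
move=> uM aM; apply: xget_unique.
  split; first exact: twisted_cubic_of.
  by move=> _ [z Tz <-].
move=> T [tT sT]; apply: twisted_cubic_eq_of_affine => // n.
by apply: sT; exists (mx_curve M n%:R) => //; rewrite affine_part_cubic //; exists n%:R.
Qed.

(** The chain with al = a, be = q and ga = - b / a: then al ga = - b, and
    al ga^2 = b^2 / a = c. *)
Lemma admissible_coefs_chain M : M \in unitmx -> affine_normal M -> admissible_coefs M ->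
  exists2 C, chain C & affine_part (cubic_of M) = proper_part C.
Proof.
move=> uM aM tM; have [a0 _ _] := admissible_coefs_diag uM aM tM.
have [M31 M32 M21 E] := tM.
set al := row_Lalg M o1; set ga := - (row_Lalg M o2 / al).
have ual : al \is a GRing.unit by rewrite unit_Lalg coefL_of.
have ga0 : coefL ga 0 = 0 by rewrite coefLN coefLM0 coefL_of M21 mul0r oppr0.
have [|C cC CE] := @chain_of_curve _ al (row_Lalg M o0) ga _ ga0.
  by rewrite coefL_of.
exists C => //; rewrite CE affine_part_cubic //; apply: eq_imagel => t _.
have alga : al * ga = - row_Lalg M o2 by rewrite mulrN mulrC divrK.
have alga2 : al * ga ^+ 2 = row_Lalg M o3.
  apply: (mulIr ual); rewrite expr2 mulrA alga mulrNN -mulrA divrK //.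
  by apply: coefLP; rewrite !(coefLM0, coefLM1, coefLM2) !coefL_of;
    rewrite ?M21 ?M31 ?M32 ?[M o3 o3 * _]mulrC ?E; ring.
by rewrite /chain_curve alga alga2 scalerN opprK.
Qed.

(** The coefficients of the curve of the chain form a matrix N.  If N were singular,
    the curve and hence the parabola would lie in a plane, which is impossible; so N
    defines a twisted cubic, and it shares the affine part with the cubic of M.
    Thus M can be replaced by N, whose entries are known. *)
Lemma chain_contact M C : M \in unitmx -> affine_normal M -> chain C ->
  affine_part (cubic_of M) = proper_part C ->
  contact 2 (cubic_of M) (cubic_of 1%:M) (@pt_f R).
Proof.
move=> uM aM /chain_curve_ex[al [be [ga [al0 ga0 ->]]]] PE.
pose lin z := row4 0 (coefL z 0) (coefL z 1) (coefL z 2).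
pose N := mx4 (aff_row be) (lin al) (lin (- (al * ga))) (lin (al * ga ^+ 2)).
have NE t : vero (1, t) *m N = aff_row (chain_curve al be ga t).
  apply: row4P; rewrite vero_mulE !mx4E !row4E /chain_curve /=.
  - by ring.
  - by rewrite !(coefLD, coefLZ, coefLN); ring.
  - by rewrite !(coefLD, coefLZ, coefLN); ring.
  - by rewrite !(coefLD, coefLZ, coefLN); ring.
have uN : N \in unitmx.
  rewrite unitmxE unitfE -det_tr; apply/negP => /eqP/eqP/det0P[v v0 vN].
  have Nv : N *m v^T = 0 by rewrite -[N]trmxK -trmx_mul vN trmx0.
  case/negP: v0; rewrite -trmx_eq0; apply/eqP.
  suff Mv : M *m v^T = 0 by rewrite -[v^T](mulKmx uM) Mv mulmx0.
  apply: vero_mul_eq0 => t; rewrite mulmxA -aff_row_curve //.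
  have : affine_part (cubic_of M) (mx_curve M t).
    by rewrite affine_part_cubic //; exists t.
  by rewrite PE => -[s _ <-]; rewrite -NE -mulmxA Nv mulmx0.
have aN : affine_normal N by split; rewrite mx4E row4E.
have tN : admissible_coefs N.
  by split; rewrite !mx4E !row4E ?expr2 ?coefLN !(coefLM0, coefLM1, coefLM2) ga0; ring.
have -> : cubic_of M = cubic_of N.
  apply: twisted_cubic_eq_of_affine => // [|n]; first exact: twisted_cubic_of.
  have -> : mx_curve N n%:R = chain_curve al be ga n%:R.
    by apply: aff_row_inj; rewrite aff_row_curve.
  suff : affine_part (cubic_of M) (chain_curve al be ga n%:R) by [].
  by rewrite PE; exists n%:R.
have [r [q1 [q2 [q3 [h [k [r0 ->]]]]]]] := admissible_coefs_model uN aN tN.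
exact: model_contact.
Qed.

Lemma affine_normal1 : affine_normal (1%:M : 'M[R]_4).
Proof. by split; rewrite mxE. Qed.

Lemma admissible_coefs1 : admissible_coefs (1%:M : 'M[R]_4).
Proof. by split; rewrite !mxE //= ?mulr1 ?expr1n. Qed.

Lemma std_parabolaE : @std_parabola R = affine_part (cubic_of 1%:M).
Proof.
rewrite affine_part_cubic ?unitmx1 //; last exact: affine_normal1.
apply: eq_imagel => t _.
have [e1 e2 e3] := coefL_mx_curve 1%:M t.
by apply: coefLP; rewrite ?e1 ?e2 ?e3 expr2 !coefLE !mxE /=; ring.
Qed.

Lemma std_osculating : osculating_plane (cubic_of 1%:M) (@plane_at_infinity R).
Proof.
have mE : 1%:M = model_mx 1 0 0 0 0 0 :> 'M[R]_4.
  by apply/row_matrixP; apply: ord4P; rewrite row1; apply: row4P; rewrite !mxE.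
have [Tf _ _] := model_contact 0 0 0 0 0 (oner_neq0 R).
have [lp [g0 g1 g2]] := model_local_param 0 0 0 0 0 (oner_neq0 R).
rewrite -mE in lp Tf; exists (@pt_f R) => //; exists (rev_mx R); first exact: rev_mx_unit.
set g := model_jet 1 0 0 0 0 0 0 in lp g0 g1 g2 *; exists g => //.
have [sg _ _ _ _] := lp.
set J := \matrix_(i < 3) _.
have J0 : row i0 J = row4 0 0 0 1.
  rewrite rowK derive1n_lift // /lift_jet -[g 0]/(derive1n 0 g 0) g0.
  by rewrite homogE mul_rev_mx !mxE.
have J1 : row i1 J = row4 0 0 1 0.
  by rewrite rowK derive1n_lift // /lift_jet g1 row_mx_row4 mul_rev_mx !mxE.
have J2 : row i2 J = row4 0 2 0 0.
  by rewrite rowK derive1n_lift // /lift_jet g2 row_mx_row4 mul_rev_mx !mxE.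
have cJ (c : 'rV[R]_3) : c *m J = row4 0 (2 * c 0 i2) (c 0 i1) (c 0 i0).
  have -> : c *m J = c 0 i0 *: row i0 J + c 0 i1 *: row i1 J + c 0 i2 *: row i2 J.
    rewrite mulmx_sum_row !big_ord_recl big_ord0 addr0 addrA.
    by congr (c 0 _ *: row _ J + c 0 _ *: row _ J + c 0 _ *: row _ J); apply: val_inj.
  by rewrite J0 J1 J2; apply: row4P; rewrite row4E !mxE /=; ring.
have x00 (x : 'rV[R]_4) : x 0 0 = x 0 o0 by congr (x _ _); apply: val_inj.
apply/seteqP; split=> x; rewrite /plane_at_infinity /= x00.
  move=> x0; apply/submxP; exists (\row_(i < 3) [:: x 0 o3; x 0 o2; x 0 o1 / 2]`_i).
  rewrite cJ !mxE /=; apply: row4P; rewrite row4E ?x0 //.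
  by field.
by move=> /submxP[c ->]; rewrite cJ row4E.
Qed.

End Main.

Theorem theorem4 (R : realType) :
  admissible (@std_parabola R) /\
  (forall P : set (Lalg R), cubic_parabola P ->
     (admissible P <->
      contact 2 (projective_extension P)
                (projective_extension (@std_parabola R)) (@pt_f R))).
Proof.
have u1 := unitmx1 R 4; have a1 := affine_normal1 R; rewrite std_parabolaE.
split.
  split; last exact: admissible_coefs_chain (admissible_coefs1 R).
  exists (cubic_of 1%:M); split=> //; first exact: twisted_cubic_of.
  exact: std_osculating.
move=> P cP; have [T [tT oT PE]] := cP.
have [M uM [TE aM]] := osculating_affine_normal tT oT.
rewrite {T}TE -/(affine_part _) in tT oT PE.
have -> : projective_extension P = cubic_of M by rewrite PE projective_extensionE.
rewrite projective_extensionE //; split.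
  by move=> [_ [C cC PC]]; apply: (chain_contact uM aM cC); rewrite -PC PE.
move=> /(contact_admissible_coefs uM aM)/(admissible_coefs_chain uM aM)[C cC CE].
by split=> //; exists C; rewrite // PE.
Qed.
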